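(* Assume that the Bateman--Horn conjecture (as stated in the context) holds. Let $\pi_2(x)$ denote the number of primes $p\le x$ for which $p+2$ is also prime, and let $\phi$ denote the Euler totient function. Then: (a) The set of twin prime pairs $p,p+2$ for which $\phi(p-1)<\phi(p+1)$ has lower density, as a subset of the twin primes, at least $0.47\%$; that is, $$\liminf_{x\to\infty}\frac{\#\{p\le x:\ p \text{ and } p+2 \text{ are prime and } \phi(p-1)<\phi(p+1)\}}{\pi_2(x)}\ \ge\ 0.0047.$$ (b) The set of twin prime pairs $p,p+2$ for which $\phi(p-1)\ge\phi(p+1)$ has lower density, as a subset of the twin primes, at least $65.13\%$; that is, $$\liminf_{x\to\infty}\frac{\#\{p\le x:\ p \text{ and } p+2 \text{ are prime and } \phi(p-1)\ge\phi(p+1)\}}{\pi_2(x)}\ \ge\ 0.6513.$$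
   Context: Bateman--Horn conjecture: Let $f_1,\dots,f_m$ be distinct irreducible (nonconstant) polynomials with integer coefficients and positive leading coefficients, and let $f=f_1f_2\cdots f_m$. Suppose that $f$ does not vanish identically modulo any prime. Let $P(x)$ be the number of positive integers $n\le x$ such that $f_1(n),\dots,f_m(n)$ are all prime. Then, as $x\to\infty$, $$P(x)\sim \frac{C}{D}\int_2^x\frac{dt}{(\log t)^m},\qquad D=\prod_{i=1}^m\deg f_i,\qquad C=\prod_{p}\frac{1-N_f(p)/p}{(1-1/p)^m},$$ where the product runs over all primes $p$ (in increasing order) and $N_f(p)$ is the number of solutions $n$ modulo $p$ to $f(n)\equiv 0\pmod p$. *)

(* Defs.v *)
From HB Require Import structures.
From mathcomp Require Import all_boot all_order all_algebra.
From mathcomp Require Import all_classical all_reals all_analysis.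
Set Implicit Arguments. Unset Strict Implicit. Unset Printing Implicit Defensive.
Import Order.TTheory GRing.Theory Num.Theory.
Import numFieldNormedType.Exports.
Local Open Scope classical_set_scope.
Local Open Scope ring_scope.

(* [Num.truncn x] is the integer part of x when 0 <= x, so this counts the
   positive integers n <= x such that Q n. *)
Definition count_upto (R : realType) (Q : pred nat) (x : R) : nat :=
  count Q (iota 1 (Num.truncn x)).

Definition primez (z : int) : bool := (0 < z) && prime `|z|%N.

(* Ring-theoretic irreducibility. It is not [irreducible_poly], which on
   {poly int} relies on pseudo-division and so ignores constant factors. *)
Definition irreducible_elt (A : comUnitRingType) (a : A) : Prop :=
  a \isn't a GRing.unit /\
  forall b c : A, a = b * c -> b \is a GRing.unit \/ c \is a GRing.unit.

Definition num_roots_mod (g : {poly int}) (p : nat) : nat :=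
  #|[pred n : 'I_p | (p%:Z %| g.[n%:Z])%Z]|.

(* Vanishing is meant as a function on Z/pZ, not coefficientwise. *)
Definition vanishes_mod (g : {poly int}) (p : nat) : Prop :=
  forall n : int, (p%:Z %| g.[n])%Z.

(* The product converges only conditionally in general, hence the limit of the
   partial products over the primes p < N. *)
Definition BH_constant (R : realType) (m : nat) (g : {poly int}) : R :=
  limn (fun N : nat => \prod_(0 <= p < N | prime p)
    ((1 - (num_roots_mod g p)%:R / p%:R) / (1 - p%:R^-1) ^+ m) : R).

Definition Bateman_Horn (R : realType) : Prop :=
  forall (m : nat) (f : 'I_m -> {poly int}),
    (0 < m)%N ->
    injective f ->
    (forall i, [/\ irreducible_elt (f i), (1 < size (f i))%N
                 & 0 < lead_coef (f i)]) ->
    (forall p : nat, prime p -> ~ vanishes_mod (\prod_(i < m) f i) p) ->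
    let D : nat := (\prod_(i < m) (size (f i)).-1)%N in
    let C : R := BH_constant R m (\prod_(i < m) f i) in
    let P (x : R) : R :=
      (count_upto (fun n => [forall i, primez (f i).[n%:Z]]) x)%:R in
    P x / (C / D%:R * \int[@lebesgue_measure R]_(t in `[2, x]) (ln t ^- m))
      @[x --> +oo] --> (1 : R).

Definition twin_prime (p : nat) : bool := prime p && prime (p + 2).

Definition twin_prime_lower_density (R : realType) (Q : pred nat) : \bar R :=
  limf_einf (fun x : R =>
    ((count_upto (fun p => twin_prime p && Q p) x)%:R
       / (count_upto twin_prime x)%:R)%:E) +oo%R.

(* Main.v *)
(* For twin primes p > 3 the number p + 1 is divisible by 6, so phi(p + 1) <= (p + 1) / 3,
   and everything depends on the prime factors of p - 1 and p + 1.  Under Bateman-Horn the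
   twin primes are equidistributed over the q - 2 possible nonzero residue classes modulo a
   prime q >= 5, independently for distinct q: all these classes have the same
   Bateman-Horn constant.  Fixing p modulo 30 (b), or modulo 30030 (a), determines the
   contribution of the small primes to phi(n) / n for n = p - 1, p + 1; the other prime
   factors q of n contribute a factor at least 1 - sum 1/q, and by Markov's inequality this
   sum is rarely large, since its mean is at most sum_q 1 / (q (q - 2)).  Bateman-Horn
   gives no uniformity in q, so the part of the mean coming from large q is bounded by an
   upper bound sieve for the twin primes in a residue class modulo q. *)
Require Import Defs.
From HB Require Import structures.
From mathcomp Require Import all_boot all_order all_algebra.
From mathcomp Require Import all_classical all_reals all_analysis.
From mathcomp Require Import zify ring lra.
Import Order.TTheory GRing.Theory Num.Theory.
Import numFieldNormedType.Exports.
Local Open Scope ring_scope.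

Set Implicit Arguments.
Unset Strict Implicit.

(** * Periodic sums *)

(** The tail over large [q] is the obstacle. Twin primes up to [X] number about [X / ln X ^ 2],
    whereas a class modulo [q] holds about [X / q] integers; summed over [q > w] with weight
    [1 / q], the trivial bound gives [X / w], too large by [ln X ^ 2] for fixed [w]. A sieve that
    saves [ln X ^ 2] up to any constant is enough, since [w] may be taken large. It is applied for
    [q <= X ^ (1 / 16)]; beyond that the trivial bound already saves a power of [X]. All comparisons
    are made up to [o] of the number of twin primes, whose lower bound of order [X / ln X ^ 2] is
    extracted from Bateman-Horn itself. Numerically, in a class where the small primes leave room
    [t] for the sum of [1 / q], Markov's inequality keeps the proportion [1 - e / t], with [e] a
    bound for the mean. Both stated densities depend on a sharp [e]. *)

Lemma affine_mod_inj (k l c : nat) : coprime k l ->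
  injective (fun m : 'I_l => (k * m + c) %% l)%N.
Proof.
move=> ckl i j /= /eqP; rewrite eqn_modDr => /eqP e.
apply/val_inj => /=; wlog le_ij : i j e / (i <= j)%N.
  by move=> H; case/orP: (leq_total i j) => h; [|apply/esym]; apply: H.
have /eqP := e; rewrite eq_sym eqn_mod_dvd ?leq_mul // -mulnBr.
rewrite Gauss_dvdr 1?coprime_sym // => d.
apply/eqP; rewrite eqn_leq le_ij -subn_eq0; case: (posnP (j - i)) => // pos.
by have := dvdn_leq pos d; rewrite leqNgt (leq_ltn_trans (leq_subr _ _) (ltn_ord j)).
Qed.

Lemma sum_affine_mod (V : nmodType) (k l c : nat) (f : nat -> V) : coprime k l ->
  \sum_(m < l) f ((k * m + c) %% l)%N = \sum_(m < l) f m.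
Proof.
case: l => [|l] ckl; first by rewrite !big_ord0.
pose g (m : 'I_l.+1) : 'I_l.+1 := inord ((k * m + c) %% l.+1).
have gE m : g m = ((k * m + c) %% l.+1)%N :> nat by rewrite inordK // ltn_mod.
have gI : injective g.
  by move=> i j e; apply: (@affine_mod_inj k l.+1 c ckl); rewrite -!gE e.
rewrite [RHS](reindex_inj gI) /=.
by apply: eq_bigr => m _; rewrite gE.
Qed.

Lemma sum_crt (A : pzRingType) (k l : nat) (f g : nat -> A) : coprime k l ->
  (0 < k)%N -> (0 < l)%N ->
  (forall m, f (m %% k)%N = f m) -> (forall m, g (m %% l)%N = g m) ->
  \sum_(m < k * l) f m * g m = (\sum_(m < k) f m) * (\sum_(m < l) g m).
Proof.
case: k => // k; case: l => // l ckl _ _ fk gl.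
rewrite big_distrlr pair_big /=.
pose h (m : 'I_(k.+1 * l.+1)) : 'I_k.+1 * 'I_l.+1 := (inord (m %% k.+1), inord (m %% l.+1)).
have h1 m : (h m).1 = (m %% k.+1)%N :> nat by rewrite inordK // ltn_mod.
have h2 m : (h m).2 = (m %% l.+1)%N :> nat by rewrite inordK // ltn_mod.
have hI : injective h.
  move=> i j e; apply/val_inj => /=.
  have /eqP : i = j %[mod k.+1 * l.+1].
    by apply/eqP; rewrite chinese_remainder // -!h1 -!h2 e !eqxx.
  by rewrite !modn_small // => /eqP.
have hB : bijective h by apply: inj_card_bij => //; rewrite card_prod !card_ord.
rewrite [RHS](reindex h) /=; last exact: onW_bij.
by apply: eq_bigr => m _; rewrite h1 h2 fk gl.
Qed.

Lemma coprime_bigprod (l : nat) (s : seq nat) : prime l ->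
  {in s, forall p, prime p} -> l \notin s -> coprime l (\prod_(p <- s) p).
Proof.
move=> pl; elim: s => [|p s IH] ps; first by rewrite big_nil coprimen1.
rewrite inE negb_or big_cons coprimeMr => /andP[lp ls].
rewrite IH // ?andbT; last by move=> x xs; apply: ps; rewrite inE xs orbT.
by rewrite prime_coprime // dvdn_prime2 // ps ?mem_head.
Qed.

Lemma sum_prod_periodic (A : comPzRingType) (chi : nat -> nat -> A) (s : seq nat) :
  uniq s -> {in s, forall l, prime l} ->
  (forall l m, l \in s -> chi l (m %% l)%N = chi l m) ->
  (forall m, \prod_(l <- s) chi l (m %% \prod_(l <- s) l)%N = \prod_(l <- s) chi l m)
  /\ \sum_(m < \prod_(l <- s) l) \prod_(l <- s) chi l m
     = \prod_(l <- s) \sum_(m < l) chi l m.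
Proof.
elim: s => [|l s IH] /=.
  by move=> *; split=> [m|]; rewrite !big_nil // big_ord_recl big_ord0 big_nil addr0.
move=> /andP[ls us] ps per.
have pl : prime l by apply: ps; rewrite mem_head.
have ps' : {in s, forall l, prime l} by move=> x xs; apply: ps; rewrite inE xs orbT.
have [|IH1 IH2] := IH us ps'.
  by move=> x m xs; apply: per; rewrite inE xs orbT.
have dvd k m (x : nat) : x \in k -> (m %% (\prod_(l <- k) l) = m %[mod x])%N.
  move=> xk; apply/modn_dvdm; rewrite (big_rem x) //= dvdn_mulr //.
split.
  move=> m; apply: eq_big_seq => x xs.
  by rewrite -(per x) // dvd // per.
have c : coprime l (\prod_(p <- s) p) by apply: coprime_bigprod.
rewrite !big_cons -IH2 -(@sum_crt _ _ _ (chi l) (fun m => \prod_(l <- s) chi l m)) //.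
- by apply: eq_bigr => m _; rewrite big_cons.
- by rewrite prime_gt0.
- by rewrite big_seq prodn_cond_gt0 // => i /ps' /prime_gt0.
- by move=> m; apply: per; rewrite mem_head.
Qed.

Lemma sum_periodic_le (A : realFieldType) (f : nat -> A) (L N : nat) :
  (0 < L)%N -> (forall m, f (m %% L)%N = f m) -> (forall m, `|f m| <= 1) ->
  \sum_(m < N) f m <= (N %/ L)%:R * (\sum_(m < L) f m) + L%:R.
Proof.
move=> L0 per bd.
rewrite -(big_mkord xpredT f) {1}(divn_eq N L) (big_cat_nat _ (n := (N %/ L * L)%N)) //= ?leq_addr //.
apply: lerD.
  elim: (N %/ L)%N => [|k IH]; first by rewrite mul0n big_geq // mul0r.
  rewrite (big_cat_nat _ (n := (k * L)%N)) ?leq_mul //=.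
  rewrite -[in leRHS]natr1 mulrDl mul1r lerD //.
  rewrite -{1}[(k * L)%N]add0n mulSn big_addn addnK big_mkord le_eqVlt; apply/orP; left; apply/eqP.
  by apply: eq_bigr => i _; rewrite -(per (i + _)%N) addnC modnMDl per.
rewrite big_nat; apply: le_trans (_ : \sum_(N %/ L * L <= i < N %/ L * L + N %% L | true) (1 : A) <= _).
  rewrite -big_nat; apply: ler_sum => i _; exact: le_trans (ler_norm _) (bd _).
by rewrite sumr_const_nat addKn ler_nat ltnW // ltn_mod.
Qed.

(** * Selberg's sieve *)

(** The squarefree [d <= D] with all prime factors in [L], by branching on whether [l] divides [d].
    The floor [D %/ l] is exact, as [l * d <= D] means [d <= D %/ l]. *)
Fixpoint sqfree_upto (L : seq nat) (D : nat) : seq nat :=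
  if L is l :: L' then
    sqfree_upto L' D ++ [seq (l * d)%N | d <- sqfree_upto L' (D %/ l)]
  else nseq (0 < D)%N 1%N.

(** The sum over the same [d] of the multiplicative extension of [w], written without listing the
    [d], so that inequalities between such sums follow by induction on [L]. *)
Fixpoint mult_sum (A : pzRingType) (w : nat -> A) (L : seq nat) (D : nat) : A :=
  if L is l :: L' then mult_sum w L' D + w l * mult_sum w L' (D %/ l)
  else (0 < D)%N%:R.

Definition prime_list (L : seq nat) : bool := uniq L && all prime L.

Lemma prime_list_cons (l : nat) (L : seq nat) :
  prime_list (l :: L) = [&& prime l, l \notin L & prime_list L].
Proof. by rewrite /prime_list /= andbACA -!andbA; do !bool_congr. Qed.

Lemma sqfree_upto_bounds (L : seq nat) (D d : nat) :
  prime_list L -> d \in sqfree_upto L D -> (0 < d <= D)%N.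
Proof.
elim: L D d => [|l L IH] D d /=.
  by case: D => // D _; rewrite inE => /eqP ->.
rewrite prime_list_cons => /and3P[pl lL pL].
rewrite mem_cat => /orP[/(IH _ _ pL) //|/mapP[e /(IH _ _ pL) /andP[e0 eD] ->]].
rewrite muln_gt0 e0 prime_gt0 //=.
by rewrite mulnC (leq_trans (leq_mul eD (leqnn l))) // leq_trunc_div.
Qed.

Lemma sqfree_upto_ndvd (L : seq nat) (D d l : nat) :
  prime_list L -> d \in sqfree_upto L D -> prime l -> l \notin L -> ~~ (l %| d)%N.
Proof.
move=> + + pl; elim: L D d => [|p L IH] D d /=.
  by case: D => // D _; rewrite inE => /eqP -> _; rewrite dvdn1; case: l pl => [|[]].
rewrite prime_list_cons inE negb_or => /and3P[pp pL plL] + /andP[lp lL].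
rewrite mem_cat => /orP[dL|/mapP[e eL ->]]; first exact: IH dL lL.
by rewrite Euclid_dvdM // dvdn_prime2 // negb_or lp (IH _ _ plL eL).
Qed.

Lemma sqfree_upto_cons_prod (A : comPzRingType) (w : nat -> A) (L : seq nat)
    (l d D : nat) : prime_list (l :: L) -> d \in sqfree_upto L D ->
  \prod_(p <- l :: L | (p %| d)%N) w p = \prod_(p <- L | (p %| d)%N) w p /\
  \prod_(p <- l :: L | (p %| l * d)%N) w p = w l * \prod_(p <- L | (p %| d)%N) w p.
Proof.
rewrite prime_list_cons => /and3P[pl lL pL] dL; rewrite !big_cons.
rewrite (negbTE (sqfree_upto_ndvd pL dL pl lL)) dvdn_mulr //; split=> //.
congr (_ * _); rewrite big_seq_cond [RHS]big_seq_cond; apply: eq_bigl => p.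
case pLE: (p \in L) => //=; have /andP[_ /allP/(_ _ pLE) pp] := pL.
rewrite Euclid_dvdM // dvdn_prime2 //; case: eqP => // epl.
by rewrite -epl pLE in lL.
Qed.

Lemma sum_sqfree_upto (A : comPzRingType) (w : nat -> A) (L : seq nat) (D : nat) :
  prime_list L ->
  \sum_(d <- sqfree_upto L D) \prod_(l <- L | (l %| d)%N) w l = mult_sum w L D.
Proof.
elim: L D => [|l L IH] D pL.
  by case: D => [|D] /=; rewrite ?big_nil // big_seq1 big_nil.
have := pL; rewrite prime_list_cons => /and3P[_ _ pL'] /=.
rewrite big_cat big_map /=; congr (_ + _).
  rewrite -IH // !big_seq; apply: eq_bigr => d dL.
  by have [-> _] := sqfree_upto_cons_prod w pL dL.
rewrite -IH // mulr_sumr !big_seq; apply: eq_bigr => d dL.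
by have [_ ->] := sqfree_upto_cons_prod w pL dL.
Qed.

Lemma sqfree_upto_prod (L : seq nat) (D d : nat) :
  prime_list L -> d \in sqfree_upto L D -> (\prod_(l <- L | l %| d) l)%N = d.
Proof.
move=> pL dL; apply/eqP; rewrite -(eqr_nat int) natr_prod; apply/eqP.
elim: L D d pL dL => [|l L IH] D d pL.
  by case: D => // D; rewrite inE => /eqP ->; rewrite big_nil.
have := pL; rewrite prime_list_cons => /and3P[_ _ pL'] /=.
rewrite mem_cat => /orP[dL|/mapP[e eL ->]].
  by have [-> _] := sqfree_upto_cons_prod (fun l => l%:R : int) pL dL; exact: IH dL.
have [_ ->] := sqfree_upto_cons_prod (fun l => l%:R : int) pL eL.
by rewrite (IH _ _ pL' eL) natrM.
Qed.

Lemma sqfree_upto_uniq (L : seq nat) (D : nat) :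
  prime_list L -> uniq (sqfree_upto L D).
Proof.
elim: L D => [|l L IH] D /=; first by case: D.
rewrite prime_list_cons => /and3P[pl lL pL].
rewrite cat_uniq IH // map_inj_uniq ?IH // ?andbT /=; last first.
  by move=> x y /eqP; rewrite eqn_pmul2l ?prime_gt0 // => /eqP.
apply/hasPn => _ /mapP[e _ ->]; apply/negP => /(sqfree_upto_ndvd pL).
by move=> /(_ _ pl lL); rewrite dvdn_mulr.
Qed.

Lemma size_sqfree_upto (L : seq nat) (D : nat) :
  prime_list L -> (size (sqfree_upto L D) <= D)%N.
Proof.
move=> pL; rewrite -[leqRHS](size_iota 1); apply: uniq_leq_size.
  exact: sqfree_upto_uniq.
by move=> d /(sqfree_upto_bounds pL); rewrite mem_iota add1n ltnS.
Qed.

Section sieve_functions.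
Variables (A : realFieldType) (Om : nat -> nat -> bool) (L : seq nat).

Let h (l : nat) : A := 2 / (l%:R - 2).
(* Constant off the forbidden classes, of mean [0] and mean square [h l]
   when [Om l] consists of two classes modulo [l]. *)
Let psi (l m : nat) : A := if Om l m then - 1 else h l.

Hypothesis pL : prime_list L.
Hypothesis L5 : all (leq 5) L.
Hypothesis Om_mod : forall l m, l \in L -> Om l (m %% l)%N = Om l m.
Hypothesis Om2 : forall l, l \in L -> (\sum_(m < l) Om l m)%N = 2%N.

Let ge5 l : l \in L -> (5 : A) <= l%:R.
Proof. by move=> lL; rewrite (ler_nat _ 5 l); exact: (allP L5). Qed.

Let psi_le1 l m : l \in L -> `|psi l m| <= 1.
Proof.
move=> /ge5 l5; rewrite /psi; case: ifP => _; first by rewrite normrN1.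
have l2 : 0 < l%:R - 2 :> A by lra.
by rewrite ger0_norm /h ?divr_ge0 ?(ltW l2) // ler_pdivrMr //; lra.
Qed.

Let sum_two_valued l (a b : A) : l \in L ->
  \sum_(m < l) (if Om l m then a else b) = 2 * a + (l%:R - 2) * b.
Proof.
move=> lL.
rewrite (eq_bigr (fun m : 'I_l => b + (Om l m)%:R * (a - b))); last first.
  by move=> m _; case: (Om l m); rewrite ?mul1r ?mul0r ?addr0 // addrC subrK.
rewrite big_split /= sumr_const card_ord -mulr_suml -natr_sum Om2 //.
by rewrite -mulr_natl; ring.
Qed.

Let mean0 l : l \in L -> \sum_(m < l) psi l m = 0.
Proof.
move=> lL; rewrite sum_two_valued // /h.
have /ge5 l5 := lL; have l2 : l%:R - 2 != 0 :> A by rewrite gt_eqF //; lra.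
by field.
Qed.

Let mean_sq l : l \in L -> \sum_(m < l) psi l m ^+ 2 = l%:R * h l.
Proof.
move=> lL; rewrite (eq_bigr (fun m : 'I_l => if Om l m then 1 else h l ^+ 2)).
  rewrite sum_two_valued // /h.
  have /ge5 l5 := lL; have l2 : l%:R - 2 != 0 :> A by rewrite gt_eqF //; lra.
  by field.
by move=> m _; rewrite /psi; case: ifP => // _; rewrite sqrrN expr1n.
Qed.

Let psid (d m : nat) : A := \prod_(l <- L | (l %| d)%N) psi l m.
Let hd (d : nat) : A := \prod_(l <- L | (l %| d)%N) h l.

(** The product has period [P], the product of the primes dividing [d] or [e], and
    [P <= d * e <= D ^ 2]; an incomplete period costs at most [P]. By the Chinese remainder theorem
    the mean over a period factors over primes: a prime dividing exactly one of [d], [e] contributes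
    the mean 0 of [psi], and if [d = e] each prime contributes the mean square [h l]. *)
Lemma sieve_correlation (D N d e : nat) :
  d \in sqfree_upto L D -> e \in sqfree_upto L D ->
  \sum_(m < N) psid d m * psid e m <= (d == e)%:R * (N%:R * hd d) + (D ^ 2)%:R.
Proof.
move=> dL eL.
pose chi (l m : nat) : A := (if (l %| d)%N then psi l m else 1)
  * (if (l %| e)%N then psi l m else 1).
pose s := [seq l <- L | (l %| d)%N || (l %| e)%N].
pose P := (\prod_(l <- s) l)%N.
have sub l : l \in s -> l \in L by rewrite mem_filter => /andP[].
have us : uniq s by rewrite filter_uniq //; case/andP: pL.
have ps : {in s, forall l, prime l}.
  by move=> l /sub; apply/allP; case/andP: pL.
have per l m : l \in s -> chi l (m %% l)%N = chi l m.
  by move=> /sub lL; rewrite /chi /psi Om_mod.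
have [perP sumP] := sum_prod_periodic us ps per.
have fE m : psid d m * psid e m = \prod_(l <- s) chi l m.
  rewrite /psid big_mkcond [X in _ * X]big_mkcond -big_split /= big_filter.
  rewrite [RHS]big_mkcond /=; apply: eq_bigr => l _; rewrite /chi.
  by case: (l %| d)%N; case: (l %| e)%N => //=; rewrite mul1r.
have hd_ge0 : 0 <= hd d.
  rewrite /hd big_seq_cond; apply: prodr_ge0 => l /andP[/ge5 l5 _].
  by rewrite divr_ge0 //; lra.
have P0 : (0 < P)%N.
  by rewrite /P big_seq; apply: prodn_cond_gt0 => l /ps /prime_gt0.
have PD : (P <= D ^ 2)%N.
  have [/andP[d0 dD] /andP[e0 eD]] :=
    (sqfree_upto_bounds pL dL, sqfree_upto_bounds pL eL).
  rewrite -mulnn; apply: leq_trans (leq_mul dD eD).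
  rewrite -[in leqRHS](sqfree_upto_prod pL dL) -[in leqRHS](sqfree_upto_prod pL eL).
  rewrite big_mkcond [X in (_ * X)%N]big_mkcond -big_split /= /P big_filter.
  rewrite big_mkcond !big_seq /=; apply: leq_prod => l lL.
  have l0 : (0 < l)%N by apply: prime_gt0; apply: (allP (proj2 (andP pL))).
  by case: (l %| d)%N; case: (l %| e)%N; rewrite ?muln1 ?mul1n //= leq_pmulr.
have norm1 m : `|\prod_(l <- s) chi l m| <= 1.
  rewrite normr_prod big_seq; apply: prodr_ile1 => l /sub lL.
  rewrite normr_ge0 /= /chi normrM; apply: mulr_ile1; rewrite ?normr_ge0 //.
    by case: ifP => _; rewrite ?normr1 ?psi_le1.
  by case: ifP => _; rewrite ?normr1 ?psi_le1.
under eq_bigr do rewrite fE.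
have := @sum_periodic_le A (fun m => \prod_(l <- s) chi l m) P N P0 perP norm1.
move=> /le_trans; apply; apply: lerD; last by rewrite ler_nat.
rewrite sumP; case: eqP => [ed|ned].
  rewrite (_ : \prod_(l <- s) _ = P%:R * hd d).
    rewrite mulrA mul1r ler_wpM2r // -natrM ler_nat leq_trunc_div //.
  have sE : s = [seq l <- L | (l %| d)%N].
    by apply: eq_filter => l; rewrite -ed orbb.
  rewrite /P /hd natr_prod sE !big_filter -big_split /=.
  rewrite big_seq_cond [RHS]big_seq_cond; apply: eq_bigr => l /andP[lL ld].
  rewrite -mean_sq //; apply: eq_bigr => m _.
  by rewrite /chi -ed ld expr2.
rewrite mul0r.
have [l ls lde] : exists2 l, l \in L & (l %| d)%N != (l %| e)%N.
  apply/hasP; apply: contra_notT ned => /hasPn H.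
  rewrite -(sqfree_upto_prod pL dL) -(sqfree_upto_prod pL eL).
  rewrite big_seq_cond [RHS]big_seq_cond; apply: eq_bigl => l.
  by case lL: (l \in L) => //=; have := H _ lL; rewrite negbK => /eqP.
have ls' : l \in s.
  by rewrite mem_filter ls andbT; move: lde; do 2!case: (_ %| _)%N.
rewrite (big_rem l) //= (_ : \sum_(m < l) chi l m = 0) ?mul0r ?mulr0 //.
rewrite -[RHS](mean0 ls); apply: eq_bigr => m _; rewrite /chi.
by move: lde; do 2!case: (_ %| _)%N => //; rewrite ?mulr1 ?mul1r.
Qed.

(** A dual form of the sieve, in which no weights are optimised. The sum [W] of all [psid d] equals
    the main sum [G] at every [m] that avoids the forbidden classes, so the count times [G ^ 2] is
    at most the sum of [W ^ 2]. Near-orthogonality bounds that by [N * G] plus an error [D ^ 2] for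
    each of at most [D ^ 2] pairs. *)
Lemma selberg_sieve (D N : nat) :
  (\sum_(m < N) all (fun l => ~~ Om l m) L)%:R
    * mult_sum (fun l => 2 / (l%:R - 2)) L D ^+ 2
  <= N%:R * mult_sum (fun l => 2 / (l%:R - 2)) L D + (D ^ 4)%:R :> A.
Proof.
rewrite -/h -(sum_sqfree_upto h D pL) ; set G := \sum_(_ <- sqfree_upto L D) _.
pose W m := \sum_(d <- sqfree_upto L D) psid d m.
apply: le_trans (_ : \sum_(m < N) W m ^+ 2 <= _).
  rewrite natr_sum mulr_suml; apply: ler_sum => m _.
  case: allP => [ok|_]; last by rewrite mul0r sqr_ge0.
  rewrite mul1r (_ : W m = G) //; apply: eq_bigr => d _.
  rewrite /psid big_seq_cond [RHS]big_seq_cond; apply: eq_bigr => l /andP[lL _].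
  by rewrite /psi (negbTE (ok _ lL)).
under eq_bigr => m _ do rewrite expr2 /W big_distrlr /=.
rewrite exchange_big /=.
under eq_bigr => m _ do rewrite exchange_big /=.
apply: le_trans (_ : \sum_(d <- sqfree_upto L D) \sum_(e <- sqfree_upto L D)
   ((d == e)%:R * (N%:R * hd d) + (D ^ 2)%:R) <= _).
  by rewrite !big_seq; apply: ler_sum => d dL; rewrite !big_seq;
    apply: ler_sum => e eL; exact: sieve_correlation.
under eq_bigr => d _ do rewrite big_split /=.
rewrite big_split /= lerD //.
  rewrite mulr_sumr big_seq [leRHS]big_seq; apply: ler_sum => d dL.
  rewrite (big_rem d) //= eqxx mul1r big1_seq ?addr0 // => e /=.
  rewrite mem_rem_uniq ?sqfree_upto_uniq // inE => /andP[/negbTE ed _].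
  by rewrite eq_sym ed mul0r.
rewrite !big_const_seq !count_predT !iter_addr_0 -!mulrnA ler_nat.
rewrite (_ : D ^ 4 = D ^ 2 * (D * D))%N; last by rewrite mulnn -expnD.
by apply: leq_mul => //; apply: leq_mul; exact: size_sqfree_upto.
Qed.

End sieve_functions.

(** * Lower bounds for the main sum of the sieve, and the sieve bound for twin primes *)

Lemma mult_sum_ge0 (A : realFieldType) (w : nat -> A) (L : seq nat) (D : nat) :
  {in L, forall l, 0 <= w l} -> 0 <= mult_sum w L D.
Proof.
elim: L D => [|l L IH] D w0 /=; first exact: ler0n.
have w0' : {in L, forall l, 0 <= w l} by move=> p pL; rewrite w0 // inE pL orbT.
by rewrite addr_ge0 ?IH // mulr_ge0 ?IH // w0 ?mem_head.
Qed.

Lemma le_mult_sum (A : realFieldType) (w : nat -> A) (L : seq nat) (D D' : nat) :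
  {in L, forall l, 0 <= w l} -> (D <= D')%N -> mult_sum w L D <= mult_sum w L D'.
Proof.
elim: L D D' => [|l L IH] D D' w0 DD' /=.
  by rewrite ler_nat; case: D D' DD' => [|D] [|D'].
have w0' : {in L, forall l, 0 <= w l} by move=> p pL; rewrite w0 // inE pL orbT.
by rewrite lerD ?IH // ler_wpM2l ?w0 ?mem_head // IH // leq_div2r.
Qed.

(** Send a pair [(d, e)] to its least common multiple, which is at most [x * y]. A prime of the lcm
    divides [d] only, [e] only, or both, so it collects the total weight [2 * v l + v l ^ 2]. *)
Lemma mult_sum_mul_le (A : realFieldType) (v w : nat -> A) (L : seq nat) (x y D : nat) :
  {in L, forall l, 0 <= v l /\ 2 * v l + v l ^+ 2 <= w l} ->
  (x * y <= D)%N -> mult_sum v L x * mult_sum v L y <= mult_sum w L D.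
Proof.
elim: L x y D => [|l L IH] x y D vw xyD /=.
  rewrite -natrM ler_nat; case: x y D xyD => [|x] [|y] [|D] //.
have vw' : {in L, forall l, 0 <= v l /\ 2 * v l + v l ^+ 2 <= w l}.
  by move=> p pL; apply: vw; rewrite inE pL orbT.
have [v0 vwl] := vw l (mem_head _ _).
have w0 : {in L, forall l, 0 <= w l}.
  by move=> p /vw' [p0]; apply: le_trans; rewrite addr_ge0 ?sqr_ge0 ?mulr_ge0.
have le1 := IH _ _ _ vw' xyD.
have le2 : mult_sum v L (x %/ l) * mult_sum v L y <= mult_sum w L (D %/ l).
  apply: IH => //; apply: leq_trans (leq_div2r l xyD).
  case: l {v0 vwl vw} => [|l]; first by rewrite !divn0 ?muln0 ?mul0n.
  by rewrite leq_divRL // mulnAC leq_mul2r leq_trunc_div orbT.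
have le3 : mult_sum v L x * mult_sum v L (y %/ l) <= mult_sum w L (D %/ l).
  apply: IH => //; apply: leq_trans (leq_div2r l xyD).
  case: l {v0 vwl vw le2} => [|l]; first by rewrite !divn0 ?muln0 ?mul0n.
  by rewrite leq_divRL // -mulnA leq_mul2l leq_trunc_div orbT.
have le4 : mult_sum v L (x %/ l) * mult_sum v L (y %/ l) <= mult_sum w L (D %/ l).
  apply: le_trans le3; apply: ler_wpM2r.
    by apply: mult_sum_ge0 => p /vw' [].
  by apply: le_mult_sum; [move=> p /vw' []|exact: leq_div].
have g0 := mult_sum_ge0 (D %/ l) w0.
set X := mult_sum v L x in le1 le3 *; set Y := mult_sum v L y in le1 le2 *.
set X' := mult_sum v L (x %/ l) in le2 le4 *; set Y' := mult_sum v L (y %/ l) in le3 le4 *.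
set G := mult_sum w L (D %/ l) in le2 le3 le4 g0 *.
rewrite (_ : _ * _ = X * Y + (v l * (X' * Y) + v l * (X * Y') + v l ^+ 2 * (X' * Y')));
  last by ring.
apply: lerD => //; apply: le_trans (ler_wpM2r g0 vwl).
rewrite (_ : (2 * v l + v l ^+ 2) * G = v l * G + v l * G + v l ^+ 2 * G); last by ring.
by rewrite !lerD // ler_wpM2l // sqr_ge0.
Qed.

Lemma mult_sum_cons_le (A : realFieldType) (w : nat -> A) (l : nat) (L : seq nat) (D : nat) :
  {in l :: L, forall p, 0 <= w p} ->
  mult_sum w (l :: L) D <= (1 + w l) * mult_sum w L D.
Proof.
move=> w0 /=; rewrite mulrDl mul1r lerD2l ler_wpM2l ?w0 ?mem_head //.
by apply: le_mult_sum (leq_div _ _) => p pL; rewrite w0 // inE pL orbT.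
Qed.

Definition smooth_sum (A : unitRingType) (L : seq nat) (y : nat) : A :=
  \sum_(1 <= n < y.+1 | all (mem L) (primes n)) n%:R^-1.

(** A multiple of [l] is [l * n] with [n] again allowed to be divisible by [l], hence the unchanged
    list [l :: L] on the right. *)
Lemma smooth_sum_cons (A : realFieldType) (l : nat) (L : seq nat) (y : nat) :
  prime l -> smooth_sum A (l :: L) y
    <= smooth_sum A L y + l%:R^-1 * smooth_sum A (l :: L) (y %/ l).
Proof.
move=> pl; have l0 := prime_gt0 pl.
rewrite /smooth_sum (bigID (fun n => ~~ (l %| n)%N)) /=; apply: lerD.
  rewrite big_mkcond [leRHS]big_mkcond /=; apply: ler_sum => n _.
  have inv0 : 0 <= n%:R^-1 :> A by rewrite invr_ge0.
  case: ifP => [/andP[/allP sm ln]|_]; last by case: ifP.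
  rewrite ifT //; apply/allP => p pn; have := sm _ pn; rewrite !inE.
  case: eqP => // pE; move: pn; rewrite pE mem_primes => /and3P[_ _ ld].
  by rewrite ld in ln.
rewrite mulr_sumr -big_filter -[leRHS]big_filter le_eqVlt; apply/orP; left; apply/eqP.
transitivity (\sum_(n <- [seq (l * n)%N | n <-
    [seq n <- index_iota 1 (y %/ l).+1 | all (mem (l :: L)) (primes n)]]) n%:R^-1 : A); last first.
  by rewrite big_map; apply: eq_bigr => n _; rewrite natrM invfM.
apply/perm_big/uniq_perm.
- by rewrite filter_uniq // iota_uniq.
- rewrite map_inj_uniq ?filter_uniq ?iota_uniq // => a b /eqP.
  by rewrite eqn_pmul2l // => /eqP.
move=> n; apply/idP/mapP.
  rewrite mem_filter mem_index_iota => /andP[/andP[sm]].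
  rewrite negbK => /dvdnP[k nE]; rewrite {n}nE in sm *; rewrite muln_gt0 ltnS => /andP[/andP[k0 _] kl].
  exists k; last by rewrite mulnC.
  rewrite mem_filter mem_index_iota k0 ltnS leq_divRL // kl; apply/andP; split=> //.
  apply/allP => p pk; apply: (allP sm).
  by rewrite primesM // pk.
move=> [k]; rewrite mem_filter mem_index_iota ltnS leq_divRL // => /and3P[sm k0 kl] ->.
rewrite mem_filter mem_index_iota muln_gt0 l0 k0 ltnS (mulnC l) kl dvdn_mull //= !andbT.
apply/allP => p; rewrite primesM // => /orP[/(allP sm) //|].
by rewrite primes_prime // inE => /eqP ->; exact: mem_head.
Qed.

(** Group the [n] by radical [d <= n <= y]: the sum of [1 / n] over all [n] of radical [d] is the
    product of [1 / (l - 1)] over the primes [l] of [d]. The geometric series is summed by strong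
    induction, through [(1 + 1 / (l - 1)) / l = 1 / (l - 1)]. *)
Lemma smooth_sum_le (A : realFieldType) (L : seq nat) (y : nat) :
  all prime L -> smooth_sum A L y <= mult_sum (fun l => (l%:R - 1)^-1) L y.
Proof.
have mono K (x z : nat) : (x <= z)%N -> smooth_sum A K x <= smooth_sum A K z.
  move=> xz; rewrite /smooth_sum (big_cat_nat (n := x.+1) _ (p := z.+1)) //= lerDl.
  by apply: sumr_ge0 => n _; rewrite invr_ge0.
elim: L y => [|l L IH] y /=.
  case: y => [|y] _; first by rewrite /smooth_sum big_geq.
  rewrite /smooth_sum big_ltn_cond //= big1_seq ?addr0 ?invr1 // => n /andP[].
  rewrite mem_index_iota => pn /andP[n1 _]; exfalso; move: pn.
  by have := pi_pdiv n; rewrite n1 => h; move: (h); rewrite /(_ \in _) /=; case: (primes n).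
move=> /andP[pl pL].
have l2 : 2 <= l%:R :> A by rewrite (ler_nat _ 2) prime_gt1.
suff H z : smooth_sum A (l :: L) z
    <= smooth_sum A L z + (l%:R - 1)^-1 * smooth_sum A L (z %/ l).
  apply: le_trans (H y) _; rewrite lerD ?IH // ler_wpM2l ?IH // invr_ge0; lra.
elim/ltn_ind: z => z IHz.
have [->|z0] := posnP z.
  by rewrite div0n /smooth_sum !big_geq // mulr0 addr0.
apply: le_trans (smooth_sum_cons _ _ _ pl) _; rewrite lerD2l.
have := IHz (z %/ l)%N (ltn_Pdiv (prime_gt1 pl) z0).
have := mono L _ _ (leq_div (z %/ l) l).
set a := smooth_sum _ _ _; set b := smooth_sum _ _ _; set c := smooth_sum _ _ _.
move=> ab cb; apply: le_trans (_ : l%:R^-1 * (b + (l%:R - 1)^-1 * b) <= _).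
  rewrite ler_wpM2l ?invr_ge0 ?ler0n //; apply: le_trans cb _.
  by rewrite lerD2l ler_wpM2l // invr_ge0; lra.
rewrite le_eqVlt; apply/orP; left; apply/eqP; field.
by rewrite !gt_eqF //; lra.
Qed.

Lemma ln_le_harmonic (R : realType) (y : nat) :
  ln (y.+1%:R : R) <= \sum_(1 <= n < y.+1) n%:R^-1.
Proof.
elim: y => [|y IH]; first by rewrite ln1 big_geq.
have y1 : 0 < y.+1%:R :> R by rewrite ltr0n.
rewrite big_nat_recr //= (_ : y.+2%:R = y.+1%:R * (1 + y.+1%:R^-1) :> R); last first.
  by rewrite mulrDr mulr1 mulfV ?gt_eqF // natr1.
have i0 : 0 < y.+1%:R^-1 :> R by rewrite invr_gt0.
by rewrite lnM ?posrE ?addr_gt0 // lerD // le_ln1Dx // (lt_trans _ i0) // ltrN10.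
Qed.

Lemma sum_dvd_affine (l k c : nat) : (0 < l)%N -> coprime k l ->
  (\sum_(m < l) (l %| k * m + c) = 1)%N.
Proof.
move=> l0 ckl.
rewrite (eq_bigr (fun m : 'I_l => nat_of_bool (l %| (k * m + c) %% l)%N)); last first.
  by move=> m _; rewrite /dvdn modn_mod.
rewrite (@sum_affine_mod nat k l c (fun r => nat_of_bool (l %| r)%N)) //.
rewrite -(big_mkord xpredT (fun r => nat_of_bool (l %| r)%N)) big_ltn // dvdn0.
rewrite big_nat_cond big1 // => r; rewrite andbT => /andP[r0 rl].
by rewrite gtnNdvd.
Qed.

Lemma count_le_size_in (T U : eqType) (P : pred T) (Q : pred U) (s : seq T)
    (t : seq U) (f : T -> U) : uniq s ->
  {in s, forall x, P x -> f x \in t /\ Q (f x)} ->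
  {in s &, forall x y, P x -> P y -> f x = f y -> x = y} ->
  (count P s <= count Q t)%N.
Proof.
move=> us PQ inj; rewrite -size_filter -(size_map f) -[leqRHS]size_filter.
apply: uniq_leq_size.
  rewrite map_inj_in_uniq ?filter_uniq // => x y.
  by rewrite !mem_filter => /andP[Px xs] /andP[Py ys]; apply: inj.
move=> _ /mapP[x + ->]; rewrite !mem_filter => /andP[Px xs].
by have [-> ->] := PQ x xs Px.
Qed.

Definition twin_class (Q : pred nat) (X : nat) : nat :=
  count (fun p => twin_prime p && Q p) (iota 1 X).

(** With [p = q * m + b], the integers [m] are sieved by the primes [5 <= l <= y] other than [q],
    each forbidding the two classes where [l] divides [p] or [p + 2]. Modulo 2 these classes
    coincide, and for [l = 3] the value [2 / (l - 2)] exceeds 1, so 2 and 3 are left out. The level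
    [y * y] yields the error [y ^ 8]; the last [y] pays for the [p <= y], which may be sieving
    primes themselves. *)
Lemma twin_class_sieve (R : realType) (q b X y : nat) :
  prime q -> (5 <= q)%N -> 16 <= ln (y.+1%:R : R) ^+ 2 ->
  (twin_class (fun p => (p %% q == b)%N) X)%:R
    <= 16 * (X %/ q).+1%:R / ln (y.+1%:R : R) ^+ 2 + (y ^ 8 + y)%:R.
Proof.
move=> pq q5 ln16; set N := (X %/ q).+1; set lnsq := ln _ ^+ 2 in ln16 *.
pose L := [seq l <- iota 5 (y - 4) | prime l && (l != q)].
have inL l : l \in L -> [/\ prime l, l != q & (5 <= l)%N].
  by rewrite mem_filter mem_iota => /andP[/andP[-> ->] /andP[-> _]].
have pL : prime_list L.
  by rewrite /prime_list filter_uniq ?iota_uniq //=; apply/allP => l /inL[].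
have L5 : all (leq 5) L by apply/allP => l /inL[].
pose Om (l m : nat) := (l %| q * m + b)%N || (l %| q * m + b + 2)%N.
have Om_mod l m : l \in L -> Om l (m %% l)%N = Om l m.
  move=> _; rewrite /Om /dvdn.
  have E c : (q * (m %% l) + c = q * m + c %[mod l])%N.
    by rewrite -modnDml modnMmr modnDml.
  by rewrite -!addnA !E.
have Om2 l : l \in L -> (\sum_(m < l) Om l m)%N = 2%N.
  move=> /inL[pl lq l5].
  have cql : coprime q l by rewrite prime_coprime // dvdn_prime2 // eq_sym.
  rewrite (eq_bigr (fun m : 'I_l => (l %| q * m + b) + (l %| q * m + (b + 2)))%N).
    by rewrite big_split /= !sum_dvd_affine // prime_gt0.
  move=> m _; rewrite /Om -addnA.
  case d1: (l %| q * m + b)%N; case d2: (l %| q * m + (b + 2))%N => //.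
  by move: d2; rewrite addnA dvdn_addr // => d2; have := @dvdn_leq l 2 isT d2; lia.
pose k (l : nat) : R := (l%:R - 1)^-1.
pose h (l : nat) : R := 2 / (l%:R - 2).
(* The harmonic sum up to [y] involves all primes up to [y]. Putting back 2, 3 and [q] costs at most
   the factor [2 * (3 / 2) * (5 / 4) = 15 / 4]. *)
have Ege : ln (y.+1%:R : R) / 4 <= mult_sum k L y.
  have k0 (l : nat) : (1 < l)%N -> 0 <= k l.
    by move=> l1; rewrite invr_ge0 subr_ge0 ler1n ltnW.
  have k0L : {in L, forall l, 0 <= k l} by move=> l /inL[/prime_gt1 /k0].
  have k0q : {in q :: L, forall l, 0 <= k l}.
    by move=> l; rewrite inE => /orP[/eqP ->|/k0L //]; apply/k0/prime_gt1.
  have k03 : {in 3%N :: q :: L, forall l, 0 <= k l}.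
    by move=> l; rewrite inE => /orP[/eqP ->|/k0q //]; apply/k0.
  have k02 : {in 2%N :: 3%N :: q :: L, forall l, 0 <= k l}.
    by move=> l; rewrite inE => /orP[/eqP ->|/k03 //]; apply/k0.
  have E0 := mult_sum_ge0 y k0L.
  have le1 := mult_sum_cons_le y k0q.
  have le2 := mult_sum_cons_le y k03.
  have le3 := mult_sum_cons_le y k02.
  have kq : k q <= 4^-1.
    have qR : 5 <= q%:R :> R by rewrite (ler_nat _ 5).
    by rewrite /k lef_pV2 ?posrE //; lra.
  have k3 : k 3%N = 2^-1 by rewrite /k; congr (_^-1); lra.
  have k2 : k 2%N = 1 by rewrite /k (_ : 2 - 1 = 1 :> R) ?invr1 //; lra.
  have : ln (y.+1%:R : R) <= mult_sum k [:: 2%N, 3%N, q & L] y.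
    apply: le_trans (ln_le_harmonic R y) _.
    apply: le_trans (smooth_sum_le _ y _); last first.
      by rewrite /= pq; case/andP: pL.
    rewrite /smooth_sum le_eqVlt; apply/orP; left; apply/eqP; rewrite big_nat_cond [RHS]big_nat_cond.
    apply: eq_bigl => n; rewrite andbT; case: andP => //= -[n1 ny]; apply/esym/allP => p.
    rewrite mem_primes => /and3P[pp _ /(dvdn_leq n1) pn].
    rewrite !inE mem_filter mem_iota pp /=.
    move: pp pn ny; rewrite ltnS; case: eqP => [//|n2]; case: eqP => [//|n3].
    case: eqP => [//|_] /= pp pn ny.
    have p5 : (4 < p)%N by case: p pp n2 n3 {pn} => [|[|[|[|[|p]]]]].
    by rewrite p5 /=; move: p5 pn ny; clear; lia.
  move: le1 le2 le3 kq E0; rewrite k2 k3; set E := mult_sum k L y.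
  set E1 := mult_sum k _ y; set E2 := mult_sum k _ y; set E3 := mult_sum k _ y.
  move=> le1 le2 le3 kq E0 lnE.
  have := ler_wpM2r E0 kq; rewrite mulrDl mul1r in le1; lra.
(* The square of the logarithm comes from multiplying two sums of length [y]. The weights compare
   because [h l - (2 * k l + k l ^ 2) = l / ((l - 2) * (l - 1) ^ 2)]. *)
have Gge : lnsq / 16 <= mult_sum h L (y * y).
  apply: le_trans (_ : mult_sum k L y * mult_sum k L y <= _).
    rewrite (_ : lnsq / 16 = (ln y.+1%:R / 4) * (ln y.+1%:R / 4)); last first.
      by rewrite /lnsq; field.
    by have l0 : 0 <= ln (y.+1%:R : R) / 4 by [rewrite divr_ge0 // ln_ge0 // ler1n];
      apply: ler_pM.
  apply: mult_sum_mul_le => // l /inL[_ _ l5].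
  have lR : 5 <= l%:R :> R by rewrite (ler_nat _ 5).
  split; first by rewrite invr_ge0; lra.
  rewrite /k /h -subr_ge0.
  rewrite (_ : _ - _ = l%:R / ((l%:R - 2) * (l%:R - 1) ^+ 2)).
    by rewrite divr_ge0 ?mulr_ge0 ?sqr_ge0 //; lra.
  by field; rewrite !gt_eqF //=; lra.
set G := mult_sum h L (y * y) in Gge.
(* From [16 <= lnsq]; it keeps the error [y ^ 8] from growing on division by [G ^ 2]. *)
have G1 : 1 <= G by lra.
set S := (\sum_(m < N) all (fun l => ~~ Om l m) L)%N.
have Sle : S%:R <= 16 * N%:R / lnsq + (y ^ 8)%:R.
  have := @selberg_sieve R Om L pL L5 Om_mod Om2 (y * y) N.
  rewrite -/h -/G -/S (_ : (y * y) ^ 4 = y ^ 8)%N; last by rewrite mulnn -expnM.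
  move=> H; have : S%:R <= N%:R / G + (y ^ 8)%:R.
    rewrite -(ler_pM2r (_ : 0 < G ^+ 2)); last by rewrite exprn_gt0 //; lra.
    apply: le_trans H _; rewrite mulrDl.
    rewrite (_ : N%:R / G * G ^+ 2 = N%:R * G); last by field; rewrite gt_eqF //; lra.
    by rewrite lerD2l ler_peMr ?ler0n // exprn_ege1.
  move=> /le_trans; apply; rewrite lerD2r mulrAC [leRHS]mulrC ler_wpM2l ?ler0n //.
  rewrite -[leRHS]invrK invf_div lef_pV2 ?posrE //; lra.
suff : (twin_class (fun p => (p %% q == b)%N) X <= S + y)%N.
  rewrite -(ler_nat R) => /le_trans; apply; rewrite !natrD addrA lerD2r //.
pose big p := twin_prime p && (p %% q == b)%N && (y < p)%N.
have : (twin_class (fun p => (p %% q == b)%N) X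
    <= count big (iota 1 X) + count (fun p => p <= y)%N (iota 1 X))%N.
  rewrite -count_predUI; apply: leq_trans (leq_addr _ _); apply: sub_count => p /= Pp.
  by rewrite /big Pp /= ltnNge orNb.
move=> /leq_trans; apply; apply: leq_add; last first.
  rewrite -[leqRHS](size_iota 1) -size_filter; apply: uniq_leq_size.
    by rewrite filter_uniq ?iota_uniq.
  by move=> p; rewrite mem_filter !mem_iota !add1n !ltnS => /andP[-> /andP[-> _]].
have -> : S = count (fun m => all (fun l => ~~ Om l m) L) (iota 0 N).
  rewrite /S -(big_mkord xpredT (fun m => nat_of_bool (all (fun l => ~~ Om l m) L))).
  by rewrite -sum1_count [RHS]big_mkcond /index_iota subn0; apply: eq_bigr => m _; case: ifP.
apply: (@count_le_size_in _ _ _ _ _ _ (fun p => p %/ q)%N); first exact: iota_uniq.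
  move=> p; rewrite mem_iota add1n ltnS => /andP[_ pX] /andP[/andP[/andP[p1 p2] /eqP pb] yp].
  rewrite mem_iota /N ltnS leq_div2r //; split=> //.
  apply/allP => l; rewrite mem_filter mem_iota => /andP[/andP[pl lq] /andP[l5 ly]].
  rewrite /Om -pb mulnC -divn_eq negb_or !dvdn_prime2 //.
  have lp : (l < p)%N by move: l5 ly yp; clear; lia.
  by rewrite !ltn_eqF // ltn_addr.
move=> p1 p2 _ _ /andP[/andP[_ /eqP b1] _] /andP[/andP[_ /eqP b2] _] e.
by rewrite (divn_eq p1 q) (divn_eq p2 q) e b1 b2.
Qed.

(** * Twin primes in residue classes under Bateman-Horn *)

Definition lin_poly (M c : nat) : {poly int} := M%:Z *: 'X + c%:Z%:P.

Lemma lin_polyE (M c n : nat) : (lin_poly M c).[n%:Z] = (M * n + c)%N%:Z.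
Proof. by rewrite /lin_poly !hornerE -PoszM -PoszD. Qed.

Lemma size_lin_poly (M c : nat) : (0 < M)%N -> size (lin_poly M c) = 2%N.
Proof.
move=> M0; have M0' : M%:Z != 0 by rewrite eqz_nat -lt0n.
have sX : size (M%:Z *: 'X : {poly int}) = 2%N by rewrite size_scale // size_polyX.
by rewrite /lin_poly size_polyDl ?sX // (leq_ltn_trans (size_polyC_leq1 _)).
Qed.

Lemma coef_lin_poly (M c : nat) :
  (lin_poly M c)`_0 = c%:Z /\ (lin_poly M c)`_1 = M%:Z.
Proof. by rewrite /lin_poly !coefE /= mulr0 mulr1 add0r addr0. Qed.

(** Degrees force one factor to be an integer constant; it divides both coefficients [M] and [c], so
    coprimality makes it a unit. *)
Lemma lin_poly_irreducible (M c : nat) : (0 < M)%N -> coprime M c ->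
  irreducible_elt (lin_poly M c).
Proof.
move=> M0 cMc; split; first by rewrite poly_unitE size_lin_poly.
have key (b d : {poly int}) : lin_poly M c = b * d -> size b = 1%N -> b \is a GRing.unit.
  move=> e sb; rewrite poly_unitE sb eqxx /=.
  have /size_poly1P[k k0 bE] : size b == 1%N by rewrite sb.
  have [c0 c1] := coef_lin_poly M c; rewrite bE coefC /=.
  have d0 : (`|k| %| c)%N.
    by rewrite -[c]/(`|c%:Z|%N) -c0 e bE coefCM abszM dvdn_mulr.
  have d1 : (`|k| %| M)%N.
    by rewrite -[M]/(`|M%:Z|%N) -c1 e bE coefCM abszM dvdn_mulr.
  have : (`|k| %| 1)%N by rewrite -(eqP cMc) dvdn_gcd d0 d1.
  rewrite dvdn1 => {bE k0 d0 d1}.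
  by case: k => [[|[|n]]|[|n]] // _; rewrite ?unitrN1 ?unitr1.
move=> b d e.
have nz : b * d != 0 by rewrite -e -size_poly_gt0 size_lin_poly.
have [b0 d0] : b != 0 /\ d != 0 by move: nz; rewrite mulf_eq0 negb_or => /andP[].
have := size_lin_poly c M0; rewrite e size_mul // => sz.
have sb : (0 < size b)%N by rewrite size_poly_gt0.
have sd : (0 < size d)%N by rewrite size_poly_gt0.
have [s1|s1] : size b = 1%N \/ size d = 1%N by lia.
  by left; apply: key e s1.
by right; apply: (key d b) s1; rewrite mulrC.
Qed.

Lemma primez_nat (n : nat) : primez n%:Z = prime n.
Proof. by rewrite /primez absz_nat ltz_nat; case: n. Qed.

Definition admissible (M a : nat) : bool := coprime M a && coprime M (a + 2).

Definition twin_polys (M a : nat) (i : 'I_2) : {poly int} := lin_poly M (a + 2 * i).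

Lemma twin_polys_prod (M a n : nat) :
  (\prod_(i < 2) twin_polys M a i).[n%:Z] = ((M * n + a) * (M * n + a + 2))%N%:Z.
Proof.
rewrite horner_prod big_ord_recl big_ord1 /twin_polys !lin_polyE /=.
by rewrite muln0 addn0 muln1 -addnA PoszM.
Qed.

(** If [p] does not divide [M], then [n] mapped to [M * n + a] permutes the residues modulo [p]; if
    it does, the values are constant and nonzero modulo [p]. Either way [a] disappears. *)
Lemma num_roots_twin_polys (M a p : nat) : prime p -> admissible M a ->
  num_roots_mod (\prod_(i < 2) twin_polys M a i) p
  = if (p %| M)%N then 0%N else (\sum_(r < p) (p %| r * (r + 2)))%N.
Proof.
move=> pp /andP[ca ca2].
have rE (n : 'I_p) : (p%:Z %| (\prod_(i < 2) twin_polys M a i).[n%:Z])%Z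
    = (p %| (M * n + a) * (M * n + a + 2))%N.
  by rewrite twin_polys_prod.
rewrite /num_roots_mod; case: ifP => pM.
  apply/eqP; rewrite -leqn0 leqNgt; apply/negP => /card_gt0P[n].
  rewrite inE rE -addnA Euclid_dvdM // !(@dvdn_addr (M * n)) ?dvdn_mulr //.
  case/orP => pa1.
    by have := coprime_dvdl pM ca; rewrite prime_coprime // pa1.
  by have := coprime_dvdl pM ca2; rewrite prime_coprime // pa1.
have cMp : coprime M p by rewrite coprime_sym prime_coprime // pM.
rewrite -sum1_card big_mkcond /=.
rewrite -(sum_affine_mod a (fun r => nat_of_bool (p %| r * (r + 2))%N) cMp).
apply: eq_bigr => n _; rewrite inE rE.
have -> : (p %| (M * n + a) %% p * ((M * n + a) %% p + 2))%N
    = (p %| (M * n + a) * (M * n + a + 2))%N.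
  by rewrite /dvdn -modnMm modnDml modn_mod modnMm.
by case: ifP.
Qed.

Lemma twin_polys_not_vanishing (M a p : nat) : prime p -> admissible M a ->
  ~ vanishes_mod (\prod_(i < 2) twin_polys M a i) p.
Proof.
move=> pp /andP[ca ca2] van.
have key n : (p %| (M * n + a) * (M * n + a + 2))%N.
  by have := van n%:Z; rewrite twin_polys_prod.
have [pM|pM] := boolP (p %| M)%N.
  have := key 0%N; rewrite muln0 add0n Euclid_dvdM // => /orP[] pa.
    by have := coprime_dvdl pM ca; rewrite prime_coprime // pa.
  by have := coprime_dvdl pM ca2; rewrite prime_coprime // pa.
(* [t (t + 2)] is [3] or [8]. *)
pose t := if p == 2%N then 1%N else 2%N.
have cMp : coprime M p by rewrite coprime_sym prime_coprime.
have [n nE] : exists n, (M * n + a = t %[mod p])%N.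
  have tp : (t %% p < p)%N by rewrite ltn_mod prime_gt0.
  pose g (m : 'I_p) : 'I_p := Ordinal (ltn_pmod (M * m + a) (prime_gt0 pp)).
  have gI : injective g by move=> i j [] e; apply: (affine_mod_inj cMp e).
  have [g' _ g'K] := inj_card_bij gI (leqnn _).
  exists (g' (Ordinal tp)); have := g'K (Ordinal tp).
  by move=> /(congr1 (@nat_of_ord p)) /=.
have := key n; rewrite /dvdn -modnMm -(modnDml _ 2) nE modnDml modnMm -/(dvdn _ _).
rewrite /t; case: eqP => [->|/eqP p2] //; rewrite (_ : 2 * (2 + 2) = 2 ^ 3)%N //.
by rewrite Euclid_dvdX // andbT dvdn_prime2 // (negbTE p2).
Qed.

Definition twin_class_count (M a y : nat) : nat :=
  count (fun n => prime (M * n + a) && prime (M * n + a + 2)) (iota 1 y).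

(* [C] depends on [M] only, so the residue classes can be compared with one another
   without knowing that the Euler product converges. *)
Lemma Bateman_Horn_twin (R : realType) : Bateman_Horn R -> forall M : nat, (0 < M)%N ->
  exists C : R, forall a, admissible M a ->
    (((twin_class_count M a y)%:R
        / (C * \int[@lebesgue_measure R]_(t in `[2, y%:R]) (ln t ^- 2)) : R)%R
      @[y --> \oo] --> (1 : R))%classic.
Proof.
move=> BH M M0.
exists (limn (fun N : nat => \prod_(0 <= p < N | prime p)
    ((1 - (if (p %| M)%N then 0%N else (\sum_(r < p) (p %| r * (r + 2)))%N)%:R / p%:R)
     / (1 - p%:R^-1) ^+ 2) : R)).
move=> a adm; have /andP[ca ca2] := adm.
have H1 : injective (twin_polys M a).
  move=> i j /(congr1 (fun p : {poly int} => p`_0)).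
  have [-> _] := coef_lin_poly M (a + 2 * i); have [-> _] := coef_lin_poly M (a + 2 * j).
  by move=> [] /addnI /eqP; rewrite eqn_pmul2l // => /eqP /val_inj.
have H2 i : [/\ irreducible_elt (twin_polys M a i), (1 < size (twin_polys M a i))%N
                 & 0 < lead_coef (twin_polys M a i)].
  rewrite /twin_polys lead_coefE size_lin_poly //=.
  have [_ ->] := coef_lin_poly M (a + 2 * i); rewrite ltz_nat M0; split=> //.
  apply: lin_poly_irreducible => //.
  by case: i => [[|[|//]] i] /=; rewrite ?muln0 ?addn0 ?muln1.
have := BH 2%N (twin_polys M a) isT H1 H2 (fun p pp => @twin_polys_not_vanishing M a p pp adm).
have -> : (\prod_(i < 2) (size (twin_polys M a i)).-1)%N = 1%N.
  by rewrite big1 // => i _; rewrite size_lin_poly.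
move=> /= /(cvg_comp _ _ (@cvgr_idn R)); apply: cvg_trans.
apply: near_eq_cvg; apply: nearW => y; rewrite /= divr1; congr (_%:R / (_ * _)).
  rewrite /count_upto natrK /twin_class_count; apply: eq_count => n /=.
  apply/forallP/idP => [H|/andP[p1 p2] i]; last first.
    rewrite /twin_polys lin_polyE primez_nat.
    by case: i => [[|[|//]] i] /=; rewrite ?muln0 ?addn0 ?muln1 ?addnA.
  have := H ord0; have := H (@Ordinal 2 1 isT).
  by rewrite /twin_polys !lin_polyE !primez_nat /= muln0 addn0 muln1 addnA => -> ->.
rewrite /BH_constant; congr (limn _); apply/funext => N.
by apply: eq_bigr => p pp; rewrite num_roots_twin_polys.
Qed.

(** * Order of magnitude of the number of twin primes *)

Lemma int_inv_lnsq_ge (R : realType) (x : R) : 2 <= x ->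
  (x - 2) / ln x ^+ 2 <= \int[@lebesgue_measure R]_(t in `[2, x]) (ln t ^- 2).
Proof.
move=> x2.
have m2x : measurable (`[2, x]%classic : set (measurableTypeR R)) by [].
have int_cst : (@lebesgue_measure R).-integrable `[2, x]%classic (EFin \o (fun _ : R => ln x ^- 2)).
  apply: continuous_compact_integrable; first exact: segment_compact.
  by apply: continuous_subspaceT => t; exact: cst_continuous.
have int_f : (@lebesgue_measure R).-integrable `[2, x]%classic (EFin \o (fun t : R => ln t ^- 2)).
  apply: continuous_compact_integrable; first exact: segment_compact.
  apply: continuous_in_subspaceT => t; rewrite inE /= in_itv /= => /andP[t2 _].
  have lt0 : 0 < ln t by rewrite ln_gt0 // (lt_le_trans _ t2) // ltr1n.
  apply: cvgV; first by rewrite expf_neq0 // gt_eqF.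
  have cln : (ln u @[u --> t] --> ln t)%classic.
    by apply: continuous_ln; rewrite (lt_le_trans _ t2).
  by rewrite expr2; under eq_fun do rewrite expr2; exact: cvgM.
have mE : fine (lebesgue_measure `[2, x]%classic) = x - 2 :> R.
  rewrite lebesgue_measure_itv /= lte_fin.
  by move: x2; rewrite le_eqVlt => /orP[/eqP <-|->] //; rewrite subrr ltxx.
have cE : \int[@lebesgue_measure R]_(t in `[2, x]) (ln x ^- 2) = (x - 2) / ln x ^+ 2.
  by rewrite -mE [RHS]mulrC; exact: Rintegral_cst.
rewrite -cE.
apply: le_Rintegral => // t; rewrite /= in_itv /= => /andP[t2 tx].
have lt0 : 0 < ln t by rewrite ln_gt0 // (lt_le_trans _ t2) // ltr1n.
have t0 : 0 < t by rewrite (lt_le_trans _ t2).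
have lx : ln t <= ln x by rewrite ler_ln // posrE (lt_le_trans t0).
have lx0 := lt_le_trans lt0 lx.
by rewrite lef_pV2 ?posrE ?exprn_gt0 // lerXn2r // nnegrE ltW.
Qed.

Lemma near_nat_ge (n : nat) : (\forall X \near \oo, (n <= X)%N)%classic.
Proof. by exists n. Qed.

Lemma near_natr_ge (R : realType) (b : R) : (\forall X \near \oo, b <= X%:R)%classic.
Proof.
exists (Num.truncn `|b|).+1 => // X /= bX.
apply: le_trans (ler_norm b) _; apply: ltW.
by apply: lt_le_trans (truncnS_gt _) _; rewrite ler_nat.
Qed.

(** For [v] the fourth root of [x], [ln x = 4 * ln v <= 4 * v]. *)
Lemma ln_sq_le_sqrt (R : realType) (x : R) : 1 <= x -> ln x ^+ 2 <= 16 * Num.sqrt x.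
Proof.
move=> x1; have x0 : 0 < x by exact: lt_le_trans x1.
set u := Num.sqrt x; set v := Num.sqrt u.
have u0 : 0 < u by rewrite sqrtr_gt0.
have v0 : 0 < v by rewrite sqrtr_gt0.
have uE : u = v ^+ 2 by rewrite sqr_sqrtr // ltW.
have xE : x = v ^+ 4 by rewrite (exprM v 2 2) -uE sqr_sqrtr // ltW.
have l0 : 0 <= ln x by exact: ln_ge0.
have : ln x <= 4 * v.
  by rewrite xE lnXn // -[ln v *+ 4]mulr_natl ler_pM2l // ltW // ln_sublinear.
by rewrite uE => H; nra.
Qed.

(** Positivity of the constant [C] is read off the asymptotic: the counts are nonnegative and the
    integral is positive, so a ratio near 1 forces [C > 0]. In [C / 6], a factor 2 comes from the
    ratio and a factor 3 from [X - 2 >= X / 3]. *)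
Lemma twins_lower (R : realType) : Bateman_Horn R -> exists2 c : R, 0 < c &
  (\forall X \near \oo, c * (X%:R / ln X%:R ^+ 2) <= (twin_class xpredT X)%:R)%classic.
Proof.
move=> BH; have [C HC] := Bateman_Horn_twin BH (isT : 0 < 1)%N.
have /cvgrPdist_lt/(_ (2^-1))/(_ _) := HC 0%N isT.
rewrite invr_gt0 ltr0n => /(_ isT) near1.
have twE X : twin_class_count 1 0 X = twin_class xpredT X.
  by apply: eq_count => p; rewrite /= mul1n addn0 andbT.
have ratio : (\forall X \near \oo, C * ((X%:R - 2) / ln X%:R ^+ 2) / 2 <= (twin_class xpredT X)%:R /\ 0 < C)%classic.
  near=> X.
  have X3 : (3 <= X)%N by near: X; exact: near_nat_ge.
  have X3R : 3 <= X%:R :> R by rewrite (ler_nat _ 3).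
  have : `|1 - (twin_class_count 1 0 X)%:R /
      (C * \int[@lebesgue_measure R]_(t in `[2, X%:R]) (ln t ^- 2))| < 2^-1 :> R.
    by near: X; exact: near1.
  rewrite twE; have : 2 <= X%:R :> R by lra.
  move=> /int_inv_lnsq_ge; set I := \int[_]_(t in _) _; set T := (twin_class _ _)%:R.
  have l0 : 0 < ln X%:R :> R by rewrite ln_gt0 //; lra.
  have g0 : 0 < (X%:R - 2) / ln X%:R ^+ 2 :> R by rewrite divr_gt0 ?exprn_gt0 //; lra.
  set g := (X%:R - 2) / ln X%:R ^+ 2 in g0 *; move=> gI; have I0 : 0 < I by exact: lt_le_trans gI.
  rewrite ltr_norml => /andP[_ H]; have T0 : 0 <= T by rewrite /T ler0n.
  have TC : 2^-1 < T / (C * I) by lra.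
  have CI0 : 0 < C * I.
    (* The case [C * I = 0] is included, since the inverse of 0 is 0. *)
    rewrite ltNge; apply/negP => CI; have h : T / (C * I) <= 0 by rewrite mulr_ge0_le0 ?invr_le0.
    lra.
  have C0 : 0 < C by move: CI0; rewrite pmulr_lgt0.
  split=> //; move: TC; rewrite ltr_pdivlMr // => TC.
  have h : C * g <= C * I by rewrite ler_pM2l.
  lra.
have C0 : 0 < C by near \oo%classic => X; have [] := near ratio X.
exists (C / 6); first by rewrite divr_gt0.
near=> X.
have [+ _] : C * ((X%:R - 2) / ln X%:R ^+ 2) / 2 <= (twin_class xpredT X)%:R /\ 0 < C.
  by near: X.
apply: le_trans.
have X3 : 3 <= X%:R :> R by rewrite (ler_nat _ 3); near: X; exact: near_nat_ge.
rewrite [X in _ <= X](_ : _ = C / 6 * (3 * ((X%:R - 2) / ln X%:R ^+ 2))); last by field; rewrite gt_eqF // ln_gt0 //; lra.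
rewrite ler_pM2l ?divr_gt0 // mulrA ler_wpM2r ?invr_ge0 ?sqr_ge0 //; lra.
Unshelve. all: by end_near.
Qed.

Lemma twins_unbounded (R : realType) (b : R) : Bateman_Horn R ->
  (\forall X \near \oo, b <= (twin_class xpredT X)%:R)%classic.
Proof.
move=> BH; have [c c0 Hc] := twins_lower BH.
near=> X.
have X1 : 1 < X%:R :> R by rewrite ltr1n; near: X; exact: (near_nat_ge 2).
apply: (le_trans _ (near Hc X _)) => //.
have l0 : 0 < ln X%:R :> R by rewrite ln_gt0.
have ln2 := ln_sq_le_sqrt (ltW X1).
have s0 : 0 < Num.sqrt X%:R :> R by rewrite sqrtr_gt0 (lt_trans ltr01).
have sE : X%:R = Num.sqrt X%:R ^+ 2 :> R by rewrite sqr_sqrtr ?ler0n.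
apply: le_trans (_ : c * (Num.sqrt X%:R / 16) <= _); last first.
  rewrite ler_pM2l // ler_pdivlMr ?exprn_gt0 // [leRHS]sE.
  apply: le_trans (ler_wpM2l _ ln2) _; first by rewrite divr_ge0 // ltW.
  by rewrite le_eqVlt; apply/orP; left; apply/eqP; field.
rewrite mulrA ler_pdivlMr // mulrC -ler_pdivrMl // .
apply: le_trans (ler_norm _) _; rewrite -sqrtr_sqr ler_wsqrtr //.
near: X; exact: near_natr_ge.
Unshelve. all: by end_near.
Qed.

(** The relation [u <= v + o(pi_2)]. Measuring every error against all twin primes, rather than
    against [v], makes it stable under sums and lets bounded terms be dropped. *)
Definition asym_le (R : realType) (u v : nat -> R) : Prop :=
  forall e : R, 0 < e ->
    (\forall X \near \oo, u X <= v X + e * (twin_class xpredT X)%:R)%classic.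

Lemma asym_le_leq (R : realType) (u v : nat -> R) : (forall X, u X <= v X) -> asym_le u v.
Proof.
move=> uv e e0; apply: nearW => X; apply: le_trans (uv X) _.
by rewrite lerDl mulr_ge0 ?ler0n // ltW.
Qed.

Lemma asym_le_trans (R : realType) (v u w : nat -> R) :
  asym_le u v -> asym_le v w -> asym_le u w.
Proof.
move=> uv vw e e0; have e2 : 0 < e / 2 by rewrite divr_gt0.
near=> X.
have h1 : u X <= v X + e / 2 * (twin_class xpredT X)%:R by near: X; exact: uv.
have h2 : v X <= w X + e / 2 * (twin_class xpredT X)%:R by near: X; exact: vw.
lra.
Unshelve. all: by end_near.
Qed.

Lemma asym_leD (R : realType) (u v u' v' : nat -> R) :
  asym_le u v -> asym_le u' v' -> asym_le (fun X => u X + u' X) (fun X => v X + v' X).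
Proof.
move=> uv uv' e e0; have e2 : 0 < e / 2 by rewrite divr_gt0.
near=> X.
have h1 : u X <= v X + e / 2 * (twin_class xpredT X)%:R by near: X; exact: uv.
have h2 : u' X <= v' X + e / 2 * (twin_class xpredT X)%:R by near: X; exact: uv'.
lra.
Unshelve. all: by end_near.
Qed.

Lemma asym_leZ (R : realType) (c : R) (u v : nat -> R) : 0 <= c ->
  asym_le u v -> asym_le (fun X => c * u X) (fun X => c * v X).
Proof.
rewrite le_eqVlt => /orP[/eqP <- _|c0 uv e e0].
  by apply: asym_le_leq => X; rewrite !mul0r.
have ec : 0 < e / c by rewrite divr_gt0.
near=> X.
have h1 : u X <= v X + e / c * (twin_class xpredT X)%:R by near: X; exact: uv.
apply: le_trans (ler_wpM2l (ltW c0) h1) _.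
rewrite mulrDr lerD2l mulrA (mulrC c) divfK //; exact: lt0r_neq0.
Unshelve. all: by end_near.
Qed.

Lemma asym_le_sum (R : realType) (I : Type) (s : seq I) (P : pred I) (u v : I -> nat -> R) :
  (forall i, P i -> asym_le (u i) (v i)) ->
  asym_le (fun X => \sum_(i <- s | P i) u i X) (fun X => \sum_(i <- s | P i) v i X).
Proof.
move=> uv; elim: s => [|i s IH]; first by apply: asym_le_leq => X; rewrite !big_nil.
have [Pi|Pi] := boolP (P i); last first.
  apply: asym_le_trans (_ : asym_le (fun X => \sum_(i <- s | P i) u i X) _).
    by apply: asym_le_leq => X; rewrite big_cons (negbTE Pi).
  by apply: asym_le_trans IH _; apply: asym_le_leq => X; rewrite big_cons (negbTE Pi).
apply: (@asym_le_trans _ (fun X => u i X + \sum_(j <- s | P j) u j X)).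
  by apply: asym_le_leq => X; rewrite big_cons Pi.
apply: asym_le_trans (asym_leD (uv i Pi) IH) _.
by apply: asym_le_leq => X; rewrite big_cons Pi.
Qed.

Lemma asym_le_cst (R : realType) (c : R) : Bateman_Horn R ->
  asym_le (fun=> c) (fun=> 0).
Proof.
move=> BH e e0; near=> X; rewrite add0r mulrC -ler_pdivrMr //.
by near: X; exact: twins_unbounded.
Unshelve. all: by end_near.
Qed.

(** * Equidistribution of twin primes in admissible residue classes *)

Lemma leq_twin_class (P Q : pred nat) (X : nat) :
  (forall p, P p -> Q p) -> (twin_class P X <= twin_class Q X)%N.
Proof. by move=> PQ; apply: sub_count => p /= /andP[-> /PQ]. Qed.

Lemma eq_twin_class (P Q : pred nat) (X : nat) :
  P =1 Q -> twin_class P X = twin_class Q X.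
Proof. by move=> PQ; apply: eq_count => p; rewrite /= PQ. Qed.

(** Through [p = M * n + a]. The two counts differ at the ends only: [n = 0] is outside the range of
    [twin_class_count], and for [n = X %/ M] the value [p] may exceed [X]. *)
Lemma twin_class_residue (M a X : nat) : (0 < M)%N -> (a < M)%N ->
  (twin_class (fun p => p %% M == a)%N X <= (twin_class_count M a (X %/ M)).+1)%N /\
  (twin_class_count M a (X %/ M) <= (twin_class (fun p => p %% M == a)%N X).+1)%N.
Proof.
move=> M0 aM; set Y := (X %/ M)%N; split.
  have : (twin_class (fun p => p %% M == a)%N X <=
      count (fun n => prime (M * n + a) && prime (M * n + a + 2)) (iota 0 Y.+1))%N.
    apply: (@count_le_size_in _ _ _ _ _ _ (fun p => p %/ M)%N); first exact: iota_uniq.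
      move=> p; rewrite mem_iota add1n ltnS => /andP[_ pX] /andP[/andP[p1 p2] /eqP pa].
      by rewrite mem_iota ltnS leq_div2r // -pa mulnC -divn_eq p1 p2.
    move=> p p' _ _ /andP[_ /eqP pa] /andP[_ /eqP pa'] e.
    by rewrite (divn_eq p M) (divn_eq p' M) e pa pa'.
  by move=> /leq_trans; apply; exact: (leq_add (leq_b1 _) (leqnn _)).
rewrite /twin_class_count; case YE: Y => [|Y'] //.
rewrite -(addn1 Y') iotaD count_cat /= addn0 -[leqRHS]addn1 leq_add ?leq_b1 //.
apply: (@count_le_size_in _ _ _ _ _ _ (fun n => M * n + a)%N); first exact: iota_uniq.
  move=> n; rewrite mem_iota add1n ltnS => /andP[n0 nY] /andP[p1 p2].
  rewrite mem_iota add1n ltnS /twin_prime p1 p2 addn_gt0 muln_gt0 M0 n0 /=.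
  split; last by rewrite mulnC modnMDl modn_small.
  have : (Y * M <= X)%N by exact: leq_trunc_div.
  rewrite YE mulSn; apply: leq_trans; rewrite addnC leq_add ?(ltnW aM) //.
  by rewrite mulnC leq_mul2r nY orbT.
by move=> n n' _ _ _ _ /addIn/eqP; rewrite eqn_pmul2l // => /eqP.
Qed.

Lemma twin_class_equidistributed (R : realType) (M a b : nat) : Bateman_Horn R ->
  (a < M)%N -> (b < M)%N -> admissible M a -> admissible M b ->
  asym_le (fun X => (twin_class (fun p => p %% M == a)%N X)%:R : R)
          (fun X => (twin_class (fun p => p %% M == b)%N X)%:R).
Proof.
move=> BH aM bM Ma Mb e e0; have M0 : (0 < M)%N by exact: leq_ltn_trans aM.
have [C HC] := Bateman_Horn_twin BH M0.
(* [d <= 1 / 4] ensures [1 + d <= (1 + 4 * d) * (1 - d)]; [d <= e / 8] spends at most half of [e],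
   leaving the rest for the bounded errors. *)
pose d := Num.min (e / 8) (4^-1) : R.
have d0 : 0 < d by rewrite lt_min; apply/andP; split; lra.
have [de d4] : d <= e / 8 /\ d <= 4^-1 by split; rewrite ge_min lexx ?orbT.
have near_ab : (\forall y \near \oo, (twin_class_count M a y)%:R
    <= (1 + 4 * d) * (twin_class_count M b y)%:R)%classic.
  have /cvgrPdist_lt/(_ _ d0) near_a := HC a Ma.
  have /cvgrPdist_lt/(_ _ d0) near_b := HC b Mb.
  near=> y.
  pose F : R := C * \int[@lebesgue_measure R]_(t in `[2, y%:R]) (ln t ^- 2).
  pose u := (twin_class_count M b y)%:R / F; pose v := (twin_class_count M a y)%:R / F.
  have hu : `|1 - u| < d by rewrite /u /F; near: y; exact: near_b.
  have hv : `|1 - v| < d by rewrite /v /F; near: y; exact: near_a.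
  move: hu hv; rewrite !ltr_norml => /andP[u1 u2] /andP[v1 v2].
  have F0 : 0 < F.
    rewrite ltNge; apply/negP => F0.
    have h : u <= 0 by rewrite mulr_ge0_le0 ?invr_le0 ?ler0n.
    lra.
  rewrite -(ler_pM2r (_ : 0 < F^-1)) ?invr_gt0 // -mulrA -/u -/v.
  nra.
have [N _ HN] := near_ab.
have HX : (\forall X \near \oo, (twin_class_count M a (X %/ M))%:R
    <= (1 + 4 * d) * (twin_class_count M b (X %/ M))%:R)%classic.
  by exists (N * M)%N => // X /= NX; apply: HN => /=; rewrite leq_divRL.
near=> X.
have hab : (twin_class_count M a (X %/ M))%:R
    <= (1 + 4 * d) * (twin_class_count M b (X %/ M))%:R by near: X.
have [] := twin_class_residue X M0 aM; have [] := twin_class_residue X M0 bM.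
set B := twin_class _ X; set A := twin_class _ X; set T := twin_class _ X.
rewrite -!(ler_nat R) -!natr1 => _ hB hA _.
have BT : B%:R <= T%:R :> R by rewrite ler_nat leq_twin_class.
have T8 : 8 / e * 4 <= T%:R :> R by rewrite /T; near: X; exact: twins_unbounded.
have {}T8 : 4 <= e / 8 * T%:R.
  by have := T8; rewrite -ler_pdivlMl ?divr_gt0 // invf_div.
have dT : d * T%:R <= e / 8 * T%:R by rewrite ler_wpM2r ?ler0n.
have dB : d * (twin_class_count M b (X %/ M))%:R <= d * (T%:R + 1).
  by rewrite ler_pM2l //; lra.
lra.
Unshelve. all: by end_near.
Qed.

Lemma sum_count_fibers (T : Type) (U : eqType) (P : pred T) (f : T -> U) (B : seq U)
    (s : seq T) : uniq B ->
  (\sum_(c <- B) count (fun x => P x && (f x == c)) s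
     + count (fun x => P x && (f x \notin B)) s = count P s)%N.
Proof.
move=> uB; elim: s => [|x s IH] /=; first by rewrite big1.
rewrite big_split /= addnACA IH; congr (_ + _)%N.
case: (P x) => /=; last by rewrite big1.
rewrite (eq_bigr (fun c => nat_of_bool (c == f x))) => [|c _]; last by rewrite eq_sym.
have -> : (\sum_(c <- B) (c == f x))%N = count_mem (f x) B.
  by rewrite -sum1_count [RHS]big_mkcond; apply: eq_bigr => c _; case: ifP => /= ->.
by rewrite count_uniq_mem //; case: (_ \in _).
Qed.

Lemma sum_twin_class_fibers (U : eqType) (Q : pred nat) (f : nat -> U) (B : seq U) (X : nat) :
  uniq B ->
  (\sum_(c <- B) twin_class (fun p => Q p && (f p == c)) X
     + twin_class (fun p => Q p && (f p \notin B)) X = twin_class Q X)%N.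
Proof.
move=> uB; rewrite -[RHS](sum_count_fibers _ f _ uB); congr (_ + _)%N.
  by apply: eq_bigr => c _; apply: eq_count => p /=; rewrite andbA.
by apply: eq_count => p /=; rewrite andbA.
Qed.

Definition residue_class (M : nat) (C : pred nat) : Prop :=
  exists2 a, (a < M)%N && admissible M a & C =1 (fun p => p %% M == a)%N.

Definition twin_residue (q b : nat) : bool := [&& b < q, b != 0 & b != q - 2]%N.

Lemma residue_class_step (M q b : nat) (C : pred nat) : residue_class M C ->
  prime q -> (2 < q)%N -> coprime M q -> twin_residue q b ->
  residue_class (M * q) (fun p => C p && (p %% q == b)%N).
Proof.
move=> [a /andP[aM /andP[Ma Ma2]] CE] pq q2 cMq /and3P[bq b0 b2].
have M0 : (0 < M)%N by exact: leq_ltn_trans aM.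
set x := chinese M q a b.
have xM : (x = a %[mod M])%N by exact: chinese_modl.
have xq : (x = b %[mod q])%N by exact: chinese_modr.
exists (x %% (M * q))%N.
  rewrite ltn_mod muln_gt0 M0 prime_gt0 //= /admissible coprime_modr.
  rewrite -[coprime _ (_ %% _ + 2)]coprime_modr modnDml coprime_modr !coprimeMl -[coprime M x]coprime_modr xM coprime_modr Ma.
  rewrite -[coprime M (x + 2)]coprime_modr -modnDml xM modnDml coprime_modr Ma2 /=.
  rewrite -[coprime q x]coprime_modr xq coprime_modr.
  rewrite -[coprime q (x + 2)]coprime_modr -modnDml xq modnDml coprime_modr.
  rewrite !prime_coprime // gtnNdvd ?lt0n //=.
  apply/negP => /dvdnP[[|[|k]]]; first by rewrite addn2.
    by rewrite mul1n => e; move: b2; rewrite -e addnK eqxx.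
  by rewrite !mulSn; lia.
move=> p; rewrite CE chinese_remainder // xM xq.
by rewrite (modn_small aM) (modn_small bq).
Qed.

(** The [q - 2] classes modulo [q] other than 0 and -2 hold asymptotically equal shares of [C]. They
    miss at most the two twin primes [p = q] and [p = q - 2]. *)
Lemma residue_class_density (R : realType) (M q b : nat) (C : pred nat) :
  Bateman_Horn R -> residue_class M C ->
  prime q -> (2 < q)%N -> coprime M q -> twin_residue q b ->
  asym_le (fun X => (q%:R - 2) * (twin_class (fun p => C p && (p %% q == b)%N) X)%:R : R)
          (fun X => (twin_class C X)%:R) /\
  asym_le (fun X => (twin_class C X)%:R)
    (fun X => (q%:R - 2) * (twin_class (fun p => C p && (p %% q == b)%N) X)%:R : R).
Proof.
move=> BH CM pq q2 cMq rb.
pose B := [seq c <- iota 1 q.-1 | c != q - 2]%N.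
have uB : uniq B by rewrite filter_uniq ?iota_uniq.
have BE c : (c \in B) = twin_residue q c.
  by rewrite mem_filter mem_iota /twin_residue; lia.
have sB : size B = (q - 2)%N.
  rewrite size_filter; have := count_predC (pred1 (q - 2)%N) (iota 1 q.-1).
  rewrite count_uniq_mem ?iota_uniq // mem_iota size_iota (_ : (_ <= _ < _)%N = true); last by lia.
  by rewrite (@eq_count _ (predC (pred1 (q - 2)%N)) (fun c => c != q - 2)%N) //; lia.
pose D c := twin_class (fun p => C p && (p %% q == c)%N).
have cls c : c \in B -> residue_class (M * q) (fun p => C p && (p %% q == c)%N).
  by rewrite BE => rc; exact: residue_class_step.
have equi c c' : c \in B -> c' \in B ->
    asym_le (fun X => (D c X)%:R : R) (fun X => (D c' X)%:R).
  move=> /cls[a /andP[aM adm] aE] /cls[a' /andP[aM' adm'] aE'].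
  apply: (@asym_le_trans _ (fun X => (twin_class (fun p => p %% (M * q) == a)%N X)%:R)).
    by apply: asym_le_leq => X; rewrite /D (eq_twin_class _ aE).
  apply: asym_le_trans (twin_class_equidistributed BH aM aM' adm adm') _.
  by apply: asym_le_leq => X; rewrite /D (eq_twin_class _ aE').
have bB : b \in B by rewrite BE.
have sumE X : (q%:R - 2) * (D b X)%:R = \sum_(c <- B | c \in B) (D b X)%:R :> R.
  rewrite -big_seq big_const_seq count_predT iter_addr_0 sB -[RHS]mulr_natl natrB //.
  exact: ltnW.
have fib X := sum_twin_class_fibers C (fun p => p %% q)%N X uB.
split.
  apply: (@asym_le_trans _ (fun X => \sum_(c <- B | c \in B) (D c X)%:R)).
    apply: asym_le_trans (_ : asym_le (fun X => \sum_(c <- B | c \in B) (D b X)%:R) _).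
      by apply: asym_le_leq => X; rewrite sumE.
    by apply: asym_le_sum => c cB; exact: equi.
  by apply: asym_le_leq => X; rewrite -big_seq -natr_sum ler_nat -(fib X) leq_addr.
apply: (@asym_le_trans _ (fun X => \sum_(c <- B | c \in B) (D c X)%:R + 2)).
  apply: asym_le_leq => X; rewrite -big_seq -natr_sum -natrD ler_nat -(fib X) leq_add2l.
  apply: leq_trans (_ : size [:: q; (q - 2)%N] <= _)%N => //.
  rewrite /twin_class -size_filter; apply: uniq_leq_size; first by rewrite filter_uniq ?iota_uniq.
  move=> p; rewrite mem_filter BE => /andP[/andP[/andP[p1 p2] /andP[_ nB]] _].
  have [pq0|pq0] := eqVneq (p %% q)%N 0%N.
    by move: pq0 => /eqP; rewrite -/(dvdn _ _) dvdn_prime2 // !inE eq_sym => ->.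
  have /eqP pq2 : (p %% q == q - 2)%N.
    by move: nB; rewrite /twin_residue ltn_mod prime_gt0 //= pq0 /= negbK.
  have : (q %| p + 2)%N.
    by rewrite /dvdn -modnDml pq2 subnK ?modnn // ltnW.
  by rewrite dvdn_prime2 // !inE => /eqP ->; rewrite addnK eqxx orbT.
apply: (@asym_le_trans _ (fun X => (q%:R - 2) * (D b X)%:R + 0)); last first.
  by apply: asym_le_leq => X; rewrite addr0.
apply: asym_leD; last exact: asym_le_cst.
apply: asym_le_trans (_ : asym_le (fun X => \sum_(c <- B | c \in B) (D b X)%:R) _).
  by apply: asym_le_sum => c cB; exact: equi.
by apply: asym_le_leq => X; rewrite sumE.
Qed.

(** * Prime factors of the neighbours of twin primes *)

Lemma sum_inv_sq_le (R : realFieldType) (a b : nat) : (0 < a)%N ->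
  \sum_(a.+1 <= q < b) (q%:R ^- 2) <= a%:R^-1 :> R.
Proof.
move=> a0; suff : \sum_(a.+1 <= q < b) (q%:R ^- 2) <= a%:R^-1 - (maxn a b.-1)%:R^-1 :> R.
  by move=> /le_trans; apply; rewrite gerBl invr_ge0.
elim: b => [|b IH]; first by rewrite big_geq // maxn0 subrr.
have [ba|ab] := leqP b a; first by rewrite big_geq //= ?(maxn_idPl ba) subrr.
rewrite big_nat_recr //= ?(maxn_idPr (ltnW ab)).
move: IH; rewrite (maxn_idPr (_ : (a <= b.-1)%N)); last by lia.
case: b ab => [//|b] ab /= IH.
have b0 : 0 < b%:R :> R by rewrite ltr0n; lia.
have : b.+1%:R ^- 2 <= b%:R^-1 - b.+1%:R^-1 :> R; last first.
  by move=> h; apply: le_trans (lerD IH h) _; rewrite addrA subrK.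
have b1 : 0 < b.+1%:R :> R by rewrite ltr0n.
rewrite -subr_ge0 (_ : _ - _ = 1 / (b%:R * b.+1%:R ^+ 2)).
  by rewrite divr_ge0 // mulr_ge0 ?sqr_ge0 // ltW.
by rewrite -natr1; field; rewrite natr1 !gt_eqF.
Qed.

(** Telescoping over odd [q] only, by [1 / (q * (q - 2)) = (1 / (q - 2) - 1 / q) / 2]. For [z = 17],
    summing over all integers would give [31 / 480], more than the threshold [23 / 455] used for the
    strict inequality of totients. *)
Lemma sum_inv_prime_pairs_le (R : realFieldType) (z N : nat) : odd z -> (2 < z)%N ->
  \sum_(z <= q < N | prime q) (q%:R * (q%:R - 2))^-1 <= (2 * (z%:R - 2))^-1 :> R.
Proof.
move=> oz z2; have zR : 3 <= z%:R :> R by rewrite (ler_nat _ 3).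
have [Nz|zN] := leqP N z.
  by rewrite big_geq // invr_ge0; lra.
(* At even [n] this is the value at the next odd number, so [g] drops only across odd [n]. *)
pose g (n : nat) : R := (2 * (n%:R - 2 + (~~ odd n)%:R))^-1.
suff : \sum_(z <= q < N | prime q) (q%:R * (q%:R - 2))^-1 <= (2 * (z%:R - 2))^-1 - g N.
  move=> /le_trans; apply; rewrite gerBl invr_ge0.
  have : z%:R <= N%:R :> R by rewrite ler_nat ltnW.
  have : 0 <= (~~ odd N)%:R :> R by rewrite ler0n.
  by move=> ? ?; lra.
rewrite -(subnKC (ltnW zN)); elim: (N - z)%N => [|k IH].
  by rewrite addn0 big_geq // /g oz /= addr0 subrr.
rewrite addnS big_mkcond big_nat_recr ?leq_addr //= -big_mkcond /=.
set n := (z + k)%N in IH *.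
have nR : 3 <= n%:R :> R by rewrite (ler_nat _ 3) (leq_trans z2) // leq_addr.
have gS : (if odd n then (n%:R * (n%:R - 2))^-1 else 0) = g n - g n.+1.
  rewrite /g /= -[n.+1%:R]natr1; case: (odd n) => /=.
    by field; rewrite !gt_eqF //; lra.
  by rewrite addr0 (_ : n%:R - 2 + 1 = n%:R + 1 - 2) ?subrr //; ring.
have : (if prime n then (n%:R * (n%:R - 2))^-1 else 0)
    <= (if odd n then (n%:R * (n%:R - 2))^-1 else 0) :> R.
  have i0 : 0 <= (n%:R * (n%:R - 2))^-1 :> R by rewrite invr_ge0 mulr_ge0 //; lra.
  case: ifP => [pn|_]; last by case: ifP.
  have [n2|->] := even_prime pn; last by [].
  by move: nR; rewrite n2; lra.
by rewrite gS => h; apply: le_trans (lerD IH h) _; rewrite addrA subrK.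
Qed.

(** The sieving length [y]: the errors [y ^ 8], summed over [q <= y], stay below [X] by a power,
    while [ln X <= 16 * ln (y + 1)]. *)
Lemma root16 (X : nat) : exists y, (y ^ 16 <= X < y.+1 ^ 16)%N.
Proof.
have ex : exists y, (y ^ 16 <= X)%N by exists 0%N; rewrite exp0n.
have bd y : (y ^ 16 <= X -> y <= X)%N.
  by apply: leq_trans; case: y => // y; rewrite -[X in (X <= _)%N]expn1 leq_pexp2l.
case: (ex_maxnP ex bd) => y yX maxy; exists y; rewrite yX ltnNge.
by apply/negP => /maxy; rewrite ltnn.
Qed.

Lemma twin_class_le (q b X : nat) : (0 < q)%N -> 
  (twin_class (fun p => p %% q == b)%N X <= (X %/ q).+1)%N.
Proof.
move=> q0.
apply: leq_trans (_ : count xpredT (iota 0 (X %/ q).+1) <= _)%N; last first.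
  by rewrite count_predT size_iota.
apply: (@count_le_size_in _ _ _ _ _ _ (fun p => p %/ q)%N); first exact: iota_uniq.
  move=> p; rewrite mem_iota add1n ltnS => /andP[_ pX] _.
  by rewrite mem_iota ltnS leq_div2r.
move=> p1 p2 _ _ /andP[_ /eqP b1] /andP[_ /eqP b2] e.
by rewrite (divn_eq p1 q) (divn_eq p2 q) e b1 b2.
Qed.

(** [K] depends neither on [z] nor on the residues [b q], so the tail becomes small with [1 / z].
    The sum runs up to [X + 1] because [q] may divide [p + 1]. *)
Lemma twin_class_tail (R : realType) : Bateman_Horn R -> exists2 K : R, 0 < K &
  forall (b : nat -> nat) (z : nat), (4 < z)%N ->
  (\forall X \near \oo, \sum_(z <= q < X.+2 | prime q)
       q%:R^-1 * (twin_class (fun p => p %% q == b q)%N X)%:R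
     <= K / z%:R * (twin_class xpredT X)%:R)%classic.
Proof.
move=> BH; have [c c0 Hc] := twins_lower BH.
(* [2 ^ 14 = 32 * 2 * 16 ^ 2]: the sieve bound, the sum of [1 / q ^ 2] being at most [2 / z], and
   the passage from [ln (y + 1)] to [ln X]. The extra 1 absorbs the error [5 * X / y]. *)
exists ((2 ^+ 14 + 1) / c); first by rewrite divr_gt0 // addr_gt0 // exprn_gt0.
move=> b z z4; have zR : 5 <= z%:R :> R by rewrite (ler_nat _ 5).
have zp : (4 <= z.-1)%N by lia.
(* Once [y] exceeds this bound, [sqrt (y + 1) >= 2 ^ 16 * z] and [ln (y + 1) >= 4], the latter being
   the condition of the sieve bound. *)
have [n _ Hn] := near_natr_ge ((2 ^+ 16 * z%:R) ^+ 2 + expR 4 : R).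
near=> X.
have XnX : (maxn n (maxn z 55) ^ 16 <= X)%N by near: X; exact: near_nat_ge.
have [y /andP[yX Xy]] := root16 X.
have : (maxn n (maxn z 55) < y.+1)%N.
  by rewrite -(ltn_exp2r _ _ (isT : 0 < 16)%N); exact: leq_ltn_trans Xy.
rewrite ltnS !geq_max => /and3P[ny zy y55].
set T := (twin_class xpredT X)%:R.
have lnX : c * (X%:R / ln X%:R ^+ 2) <= T by rewrite /T; near: X.
set S := (y.+1)%:R : R.
have y0 : (0 < y)%N by exact: leq_trans y55.
have yR : 55 <= y%:R :> R by rewrite (ler_nat _ 55).
have SE : S = y%:R + 1 by rewrite /S -natr1.
have S0 : 0 < S by rewrite SE; lra.
have yX1 : (y <= X)%N by apply: leq_trans yX; rewrite -[leqLHS]expn1 leq_pexp2l.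
have X0 : (0 < X)%N by exact: leq_trans yX1.
have ybig : (2 ^+ 16 * z%:R) ^+ 2 + expR 4 <= y%:R :> R by exact: (Hn y ny).
have sq0 : 0 <= (2 ^+ 16 * z%:R) ^+ 2 :> R by rewrite sqr_ge0.
have e40 : 0 < expR 4 :> R by exact: expR_gt0.
have lnS4 : 4 <= ln S.
  by rewrite -(expRK 4) ler_ln ?posrE // SE; lra.
have lnS16 : 16 <= ln S ^+ 2.
  rewrite (_ : 16 = 4 ^+ 2); last by rewrite -natrX.
  by apply: lerXn2r => //; rewrite nnegrE; lra.
have lnX0 : 0 < ln X%:R :> R.
  by rewrite ln_gt0 // ltr1n (leq_trans _ yX1) // (leq_trans _ y55).
have lnXS : ln X%:R ^+ 2 <= 16 ^+ 2 * ln S ^+ 2.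
  have h : ln X%:R <= 16 * ln S.
    rewrite mulr_natl -lnXn // ler_ln ?posrE ?exprn_gt0 ?ltr0n //.
    by rewrite /S -natrX ler_nat ltnW.
  rewrite (_ : 16 ^+ 2 * ln S ^+ 2 = (16 * ln S) ^+ 2); last by ring.
  by apply: lerXn2r => //; rewrite nnegrE; lra.
(* [ln (y + 1) ^ 2 <= 16 sqrt (y + 1)] makes the error terms [X / y] negligible. *)
have small : 5 * (X%:R / y%:R) <= z%:R^-1 * (X%:R / ln X%:R ^+ 2) :> R.
  have XR : 0 < X%:R :> R by rewrite ltr0n.
  have S1 : 1 <= S by rewrite SE; lra.
  have lnS := ln_sq_le_sqrt S1.
  set s := Num.sqrt S in lnS.
  have s0 : 0 <= s by exact: sqrtr_ge0.
  have sE : y%:R + 1 = s ^+ 2 by rewrite /s -SE sqr_sqrtr // ltW.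
  have zs : 2 ^+ 16 * z%:R <= s.
    apply: le_trans (ler_norm _) _; rewrite -sqrtr_sqr /s ler_wsqrtr // SE; lra.
  have l1 : ln X%:R ^+ 2 <= 2 ^+ 12 * s by lra.
  have l2 : 5 * (z%:R * ln X%:R ^+ 2) <= y%:R :> R.
    have h1 : z%:R * ln X%:R ^+ 2 <= z%:R * (2 ^+ 12 * s) by rewrite ler_pM2l //; lra.
    have h2 : 2 ^+ 16 * z%:R * s <= s * s by rewrite ler_wpM2r.
    by move: h2; rewrite -expr2 -sE; lra.
  have L0 : 0 < ln X%:R ^+ 2 :> R by rewrite exprn_gt0.
  rewrite (_ : 5 * (X%:R / y%:R) = X%:R * 5 / y%:R); last by ring.
  rewrite (_ : z%:R^-1 * _ = X%:R / (z%:R * ln X%:R ^+ 2)); last first.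
    by field; rewrite !gt_eqF //; lra.
  rewrite ler_pdivrMr; last by lra.
  rewrite mulrAC ler_pdivlMr; last by rewrite mulr_gt0 //; lra.
  by rewrite -mulrA ler_pM2l.
have XR : 0 < X%:R :> R by rewrite ltr0n.
have L0 : 0 < ln X%:R ^+ 2 :> R by rewrite exprn_gt0.
have M0 : 0 < ln S ^+ 2 by lra.
have yR0 : 0 < y%:R :> R by lra.
rewrite (big_cat_nat (n := y.+1)) /=; [|exact: leqW|by rewrite !ltnS leqW].
have part1 : \sum_(z <= q < y.+1 | prime q)
      q%:R^-1 * (twin_class (fun p => p %% q == b q)%N X)%:R
    <= 2 ^+ 14 / z%:R * (X%:R / ln X%:R ^+ 2) + 2 * (X%:R / y%:R) :> R.
  have term q : (z <= q < y.+1)%N -> prime q ->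
      q%:R^-1 * (twin_class (fun p => p %% q == b q)%N X)%:R
      <= 32 * X%:R / ln S ^+ 2 * q%:R ^- 2 + (y ^ 8 + y)%:R.
    rewrite ltnS => /andP[zq qy] pq.
    have q1 : 1 <= q%:R :> R by rewrite ler1n prime_gt0.
    have q0 : 0 < q%:R :> R by lra.
    have qX : (X %/ q).+1%:R <= 2 * X%:R / q%:R :> R.
      rewrite -natr1 ler_pdivlMr // mulrDl mul1r -natrM.
      have h1 : (X %/ q * q)%:R <= X%:R :> R by rewrite ler_nat leq_trunc_div.
      have h2 : q%:R <= X%:R :> R by rewrite ler_nat (leq_trans qy).
      lra.
    have h := twin_class_sieve (b q) X pq (leq_trans z4 zq) lnS16.
    apply: le_trans (ler_wpM2l _ h) _; first by rewrite invr_ge0 ltW.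
    rewrite mulrDr; apply: lerD.
      rewrite (_ : 32 * X%:R / ln S ^+ 2 * q%:R ^- 2 =
        q%:R^-1 * (16 * (2 * X%:R / q%:R) / ln S ^+ 2)); last first.
        by field; rewrite !gt_eqF // -/S; lra.
      by rewrite ler_wpM2l ?invr_ge0 ?(ltW q0) // ler_wpM2r ?invr_ge0 ?(ltW M0) // ler_wpM2l.
    by rewrite ler_piMl ?ler0n // invf_le1.
  apply: le_trans (_ : \sum_(z <= q < y.+1)
      (32 * X%:R / ln S ^+ 2 * q%:R ^- 2 + (y ^ 8 + y)%:R) <= _).
    rewrite big_mkcond big_nat_cond [leRHS]big_nat_cond; apply: ler_sum => q /andP[qz _].
    have t0 : 0 <= 32 * X%:R / ln S ^+ 2 * q%:R ^- 2 + (y ^ 8 + y)%:R.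
      by rewrite addr_ge0 ?ler0n // mulr_ge0 ?invr_ge0 ?sqr_ge0 // divr_ge0 ?sqr_ge0 ?mulr_ge0.
    by case: ifP => // pq; exact: term.
  rewrite big_split /= -mulr_sumr sumr_const_nat; apply: lerD.
    have sq : \sum_(z <= q < y.+1) (q%:R ^- 2) <= 2 / z%:R :> R.
      apply: le_trans (_ : z.-1%:R^-1 <= _).
        by rewrite -{1}(ltn_predK z4); apply: sum_inv_sq_le; exact: leq_trans zp.
      rewrite -[leRHS]invf_div lef_pV2 ?posrE; last 2 first.
      - by rewrite ltr0n; exact: leq_trans zp.
      - by rewrite divr_gt0 //; lra.
      have -> : z%:R = z.-1%:R + 1 :> R by rewrite natr1 (ltn_predK z4).
      have : 4 <= z.-1%:R :> R by rewrite (ler_nat _ 4).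
      by move=> ?; lra.
    apply: le_trans (ler_wpM2l _ sq) _; first by rewrite divr_ge0 ?(ltW M0) // mulr_ge0 // ltW.
    rewrite [leLHS](_ : _ = 2 ^+ 6 / z%:R * (X%:R / ln S ^+ 2)); last by field; rewrite !gt_eqF //; lra.
    rewrite [leRHS](_ : _ = 2 ^+ 6 / z%:R * (2 ^+ 8 * (X%:R / ln X%:R ^+ 2))); last by field; rewrite !gt_eqF //; lra.
    apply: ler_wpM2l; first by rewrite divr_ge0 ?exprn_ge0 //; lra.
    rewrite ler_pdivrMr // (_ : 2 ^+ 8 * _ * _ = X%:R * (16 ^+ 2 * ln S ^+ 2) / ln X%:R ^+ 2); last by ring.
    by rewrite ler_pdivlMr // ler_pM2l.
  rewrite mulrA ler_pdivlMr // -[leLHS]/((y ^ 8 + y)%:R *+ (y.+1 - z) * y%:R).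
  rewrite -mulrnA -!natrM ler_nat.
  apply: leq_trans (_ : (y ^ 8 + y ^ 8) * y * y <= _)%N.
    rewrite !leq_mul // ?leq_add2l; last first.
      by rewrite leq_subLR -[y.+1]add1n leq_add2r (leq_trans _ z4).
    by rewrite -[leqLHS]expn1 leq_pexp2l.
  rewrite addnn -mul2n -!mulnA leq_mul2l; apply: leq_trans yX.
  exact: (@leq_pexp2l y 10 16 y0 isT).
(* Beyond [y] the trivial bound [X / q + 1 <= 3 * X / q] is enough. *)
have part2 : \sum_(y.+1 <= q < X.+2 | prime q)
      q%:R^-1 * (twin_class (fun p => p %% q == b q)%N X)%:R
    <= 3 * (X%:R / y%:R) :> R.
  apply: le_trans (_ : \sum_(y.+1 <= q < X.+2) 3 * X%:R * q%:R ^- 2 <= _).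
    rewrite big_mkcond big_nat_cond [leRHS]big_nat_cond; apply: ler_sum => q /andP[/andP[yq qX] _].
    have t0 : 0 <= 3 * X%:R * q%:R ^- 2 :> R by rewrite !mulr_ge0 ?invr_ge0 ?sqr_ge0 // ltW.
    case: ifP => // pq; have q0 : 0 < q%:R :> R by rewrite ltr0n prime_gt0.
    have := twin_class_le (b q) X (prime_gt0 pq).
    rewrite -(ler_nat R) => /(ler_wpM2l (_ : 0 <= q%:R^-1)) h.
    apply: le_trans (h _) _; first by rewrite invr_ge0 ltW.
    rewrite (_ : 3 * X%:R * q%:R ^- 2 = q%:R^-1 * (3 * X%:R / q%:R)); last by field; rewrite gt_eqF.
    rewrite ler_wpM2l ?invr_ge0 ?(ltW q0) // ler_pdivlMr // -natr1 mulrDl mul1r -natrM.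
    have h1 : (X %/ q * q)%:R <= X%:R :> R by rewrite ler_nat leq_trunc_div.
    have h2 : q%:R <= X%:R + 1 :> R by rewrite natr1 ler_nat -ltnS.
    have h3 : 1 <= X%:R :> R by rewrite ler1n.
    lra.
  rewrite -mulr_sumr mulrA ler_wpM2l ?mulr_ge0 ?(ltW XR) //.
  exact: sum_inv_sq_le.
apply: le_trans (lerD part1 part2) _.
have hT : X%:R / ln X%:R ^+ 2 <= T / c by rewrite ler_pdivlMr // mulrC.
rewrite (_ : (2 ^+ 14 + 1) / c / z%:R * T = (2 ^+ 14 + 1) / z%:R * (T / c)); last by ring.
apply: le_trans (ler_wpM2l _ hT); last by rewrite divr_ge0 ?addr_ge0 ?exprn_ge0 //; lra.
rewrite [leRHS](_ : _ = 2 ^+ 14 / z%:R * (X%:R / ln X%:R ^+ 2)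
  + z%:R^-1 * (X%:R / ln X%:R ^+ 2)); last by ring.
rewrite -addrA lerD2l; lra.
Unshelve. all: by end_near.
Qed.

Definition inv_sum (R : unitRingType) (M n : nat) : R :=
  \sum_(q <- primes n | coprime M q) q%:R^-1.

Lemma inv_sumE (R : unitRingType) (M n N : nat) : (0 < n < N)%N ->
  inv_sum R M n = \sum_(0 <= q < N | prime q && coprime M q) (q %| n)%:R * q%:R^-1.
Proof.
move=> /andP[n0 nN]; rewrite /inv_sum.
transitivity (\sum_(q <- [seq q <- index_iota 0 N | q \in primes n] | coprime M q) (q%:R^-1 : R)).
  apply/perm_big/uniq_perm; rewrite ?primes_uniq ?filter_uniq ?iota_uniq //.
  move=> q; rewrite mem_filter mem_index_iota /= andbC; case: (boolP (q \in primes n)); last by rewrite andbF.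
  rewrite mem_primes => /and3P[_ _ /(dvdn_leq n0) qn].
  by rewrite (leq_ltn_trans qn).
rewrite big_filter_cond big_mkcond [RHS]big_mkcond; apply: eq_bigr => q _.
rewrite mem_primes n0 /=; case: (prime q) => //=; case: (q %| n)%N; case: (coprime M q) => //=.
  by rewrite mul1r.
by rewrite mul0r.
Qed.

(* Markov's inequality: in the mean of [inv_sum M (sh p)] the prime factors below a large
   [w] are controlled by equidistribution, those above [w] by the sieve. *)
Lemma twin_class_inv_sum_lt (R : realType) (M z : nat) (C : pred nat)
    (b sh : nat -> nat) (e t : R) :
  Bateman_Horn R -> residue_class M C -> (4 < z)%N ->
  (forall q, prime q -> coprime M q -> [/\ (z <= q)%N, twin_residue q (b q)
     & forall p, prime p -> (q %| sh p)%N = (p %% q == b q)%N]) ->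
  (forall p, prime p -> (0 < sh p <= p.+1)%N) ->
  (forall N, \sum_(z <= q < N | prime q) (q%:R * (q%:R - 2))^-1 <= e) ->
  0 < t ->
  asym_le (fun X => (1 - e / t) * (twin_class C X)%:R)
    (fun X => (twin_class (fun p => C p && (inv_sum R M (sh p) < t)) X)%:R).
Proof.
move=> BH CM z4 hq hsh he t0.
have [K K0 HK] := twin_class_tail BH.
pose D q := twin_class (fun p => C p && (p %% q == b q)%N).
pose Q (q : nat) := prime q && coprime M q.
have inv0 (q : nat) : 0 <= q%:R^-1 :> R by rewrite invr_ge0.
have total : asym_le (fun X => \sum_(z <= q < X.+2 | Q q) q%:R^-1 * (D q X)%:R)
    (fun X => e * (twin_class C X)%:R).
  move=> d d0.
  have [n _ Hn] := near_natr_ge (K / (d / 2)).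
  (* [w] is fixed before [X] grows: the tail takes half of the error [d], and the head is a finite
     sum in which each [q] may have its own rate of convergence. *)
  pose w := maxn n z; have wz : (z <= w)%N by rewrite leq_maxr.
  have w0 : 0 < w%:R :> R by rewrite ltr0n (leq_trans _ wz) // (leq_trans _ z4).
  have Kw : K / w%:R <= d / 2.
    have := Hn w (leq_maxl _ _); rewrite /= ler_pdivrMr ?divr_gt0 // => h.
    by rewrite ler_pdivrMr // mulrC.
  have head : asym_le (fun X => \sum_(z <= q < w | Q q) q%:R^-1 * (D q X)%:R)
      (fun X => e * (twin_class C X)%:R).
    apply: (@asym_le_trans _ (fun X => \sum_(z <= q < w | Q q)
        (q%:R * (q%:R - 2))^-1 * (twin_class C X)%:R)).
      apply: asym_le_sum => q /andP[pq cq]; have [zq rq _] := hq q pq cq.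
      have q5 : (5 <= q)%N by exact: leq_trans zq.
      have q5R : 5 <= q%:R :> R by rewrite (ler_nat _ 5).
      have q2 : (2 < q)%N by exact: leq_trans q5.
      have [dens _] := residue_class_density BH CM pq q2 cq rq.
      have i0 : 0 <= (q%:R * (q%:R - 2))^-1 :> R by rewrite invr_ge0 mulr_ge0 //; lra.
      apply: asym_le_trans (asym_leZ i0 dens).
      apply: asym_le_leq => X; rewrite /D invfM -mulrA mulKf // gt_eqF //; lra.
    apply: asym_le_leq => X; rewrite -mulr_suml ler_wpM2r //.
    apply: le_trans (he w); rewrite big_mkcond [leRHS]big_mkcond /= big_nat_cond [leRHS]big_nat_cond.
    apply: ler_sum => q /andP[/andP[zq _] _].
    have q5R : 5 <= q%:R :> R by rewrite (ler_nat _ 5) (leq_trans z4).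
    have i0 : 0 <= (q%:R * (q%:R - 2))^-1 :> R by rewrite invr_ge0 mulr_ge0 //; lra.
    by rewrite /Q; case: (prime q); case: (coprime M q).
  near=> X.
  have wX : (w <= X.+2)%N by do 2!apply: leqW; near: X; exact: near_nat_ge.
  have h1 : \sum_(z <= q < w | Q q) q%:R^-1 * (D q X)%:R
      <= e * (twin_class C X)%:R + d / 2 * (twin_class xpredT X)%:R.
    by near: X; apply: head; rewrite divr_gt0.
  have h2 : \sum_(w <= q < X.+2 | prime q)
       q%:R^-1 * (twin_class (fun p => p %% q == b q)%N X)%:R
     <= K / w%:R * (twin_class xpredT X)%:R.
    by near: X; apply: HK; exact: leq_trans wz.
  have h3 : K / w%:R * (twin_class xpredT X)%:R <= d / 2 * (twin_class xpredT X)%:R.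
    by rewrite ler_wpM2r.
  have h4 : \sum_(w <= q < X.+2 | Q q) q%:R^-1 * (D q X)%:R
      <= \sum_(w <= q < X.+2 | prime q)
       q%:R^-1 * (twin_class (fun p => p %% q == b q)%N X)%:R :> R.
    rewrite big_mkcond [leRHS]big_mkcond; apply: ler_sum => q _.
    rewrite /Q; case: (prime q) => //=; case: (coprime M q); last by rewrite mulr_ge0.
    by rewrite ler_wpM2l // ler_nat leq_twin_class // => p /andP[].
  rewrite (big_cat_nat (n := w)) //=; lra.
(* The left side is just the count of [C]. Pointwise, the indicator of [C] is at most that of
   [inv_sum < t] within [C] plus [inv_sum / t], and exchanging summations turns the total of
   [inv_sum] into the sum over [q]. *)
have markov X : (1 - e / t) * (twin_class C X)%:R
    + t^-1 * (e * (twin_class C X)%:R)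
    <= (twin_class (fun p => C p && (inv_sum R M (sh p) < t)) X)%:R
      + t^-1 * \sum_(z <= q < X.+2 | Q q) q%:R^-1 * (D q X)%:R.
  rewrite [leLHS](_ : _ = (twin_class C X)%:R); last by ring.
  have -> : \sum_(z <= q < X.+2 | Q q) q%:R^-1 * (D q X)%:R
      = \sum_(p <- iota 1 X | twin_prime p && C p) inv_sum R M (sh p) :> R.
    have -> : \sum_(z <= q < X.+2 | Q q) q%:R^-1 * (D q X)%:R
        = \sum_(0 <= q < X.+2 | Q q) q%:R^-1 * (D q X)%:R :> R.
      have [zX|Xz] := leqP z X.+2.
        rewrite [RHS](big_cat_nat (n := z)) //= [X in X + _](_ : _ = 0) ?add0r //.
        rewrite big_nat_cond big1 //.
        move=> q /andP[/andP[_ qz] /andP[pq cq]]; have [zq _ _] := hq q pq cq.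
        by rewrite leqNgt qz in zq.
      rewrite big_geq ?(ltnW Xz) //; apply/esym; rewrite big_nat_cond big1 // => q.
      move=> /andP[/andP[_ qX] /andP[pq cq]]; have [zq _ _] := hq q pq cq.
      by rewrite leqNgt (ltn_trans qX) in zq.
    rewrite [RHS]big_seq_cond [RHS](eq_bigr (fun p => \sum_(0 <= q < X.+2 | Q q)
        (q %| sh p)%:R * q%:R^-1)); last first.
      move=> p /andP[]; rewrite mem_iota add1n ltnS => /andP[p0 pX] /andP[/andP[pp _] _].
      have /andP[s0 sp] := hsh p pp; apply: inv_sumE; rewrite s0 ltnS.
      by rewrite (leq_trans sp).
    rewrite -big_seq_cond [RHS]exchange_big /=; apply: eq_bigr => q /andP[pq cq].
    have [_ _ hd] := hq q pq cq.
    rewrite -mulr_suml mulrC; congr (_ * _).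
    rewrite /D /twin_class -sum1_count natr_sum big_mkcond [RHS]big_mkcond.
    apply: eq_bigr => p _; rewrite andbA; case: (boolP (twin_prime p)) => //= /andP[pp _].
    by rewrite hd //; case: (C p); case: (_ == _).
  rewrite /twin_class -!sum1_count !natr_sum mulr_sumr.
  rewrite big_mkcond [X in _ <= X + _]big_mkcond [X in _ <= _ + X]big_mkcond -big_split /=.
  apply: ler_sum => p _; rewrite andbA; case: (_ && _) => /=; last by rewrite addr0.
  have T0 : 0 <= inv_sum R M (sh p) by apply: sumr_ge0 => q _.
  have [lt|ge] := ltP (inv_sum R M (sh p)) t.
    by rewrite lerDl mulr_ge0 // invr_ge0 ltW.
  by rewrite add0r mulrC ler_pdivlMr // mul1r.
move=> d d0; have dt : 0 < d * t by rewrite mulr_gt0.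
near=> X.
have h : \sum_(z <= q < X.+2 | Q q) q%:R^-1 * (D q X)%:R
    <= e * (twin_class C X)%:R + d * t * (twin_class xpredT X)%:R.
  by near: X; exact: total.
have ti : 0 <= t^-1 by rewrite invr_ge0 ltW.
have := ler_wpM2l ti h; rewrite mulrDr.
rewrite (_ : t^-1 * (d * t * _) = d * (twin_class xpredT X)%:R); last by field; rewrite gt_eqF.
have := markov X; lra.
Unshelve. all: by end_near.
Qed.

(** * Totients and lower densities *)

Lemma totient_prodE (R : realFieldType) (n : nat) : (0 < n)%N ->
  (totient n)%:R = n%:R * \prod_(q <- primes n) (1 - q%:R^-1) :> R.
Proof.
move=> n0; rewrite totientE // natr_prod [n in n%:R]prod_prime_decomp //.
rewrite prime_decompE big_map natr_prod -big_split /= big_seq [RHS]big_seq.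
apply: eq_bigr => q qn; have := qn; rewrite mem_primes => /and3P[pq _ _].
have : (0 < logn q n)%N by rewrite logn_gt0.
case: (logn q n) => // k _; rewrite /= expnS !natrM -subn1 natrB ?prime_gt0 //.
have q0 : q%:R != 0 :> R by rewrite pnatr_eq0 -lt0n prime_gt0.
by field.
Qed.

Lemma euler_factor_bounds (R : realFieldType) (q : nat) : prime q ->
  0 <= 1 - (q%:R^-1 : R) <= 1.
Proof.
move=> pq; have i0 : 0 <= q%:R^-1 :> R by rewrite invr_ge0.
have i1 : q%:R^-1 <= 1 :> R by rewrite invf_le1 ?ltr0n ?ler1n prime_gt0.
by apply/andP; split; lra.
Qed.

Lemma le_euler_prod (R : realFieldType) (s t : seq nat) : uniq s -> uniq t ->
  all prime t -> {subset s <= t} ->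
  \prod_(q <- t) (1 - q%:R^-1) <= \prod_(q <- s) (1 - q%:R^-1) :> R.
Proof.
move=> us ut /allP pt st; rewrite (bigID (mem s)) /=.
have -> : \prod_(q <- t | q \in s) (1 - q%:R^-1) = \prod_(q <- s) (1 - q%:R^-1) :> R.
  rewrite -big_filter; apply/perm_big/uniq_perm; rewrite ?filter_uniq // => q.
  by rewrite mem_filter; case: (boolP (q \in s)) => //= /st.
apply: ler_piMr.
  by rewrite big_seq; apply: prodr_ge0 => q /st /pt /(@euler_factor_bounds R) /andP[].
rewrite big_seq_cond; apply: prodr_ile1 => q /andP[/pt pq _].
exact: euler_factor_bounds.
Qed.

Lemma totient_le (R : realFieldType) (s : seq nat) (n : nat) : (0 < n)%N -> uniq s ->
  all (fun q => prime q && (q %| n)%N) s ->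
  (totient n)%:R <= n%:R * \prod_(q <- s) (1 - q%:R^-1) :> R.
Proof.
move=> n0 us /allP sn; rewrite totient_prodE // ler_wpM2l // le_euler_prod ?primes_uniq //.
  by apply/allP => q; rewrite mem_primes => /andP[].
by move=> q /sn /andP[pq qn]; rewrite mem_primes pq n0.
Qed.

Lemma prod_onem_ge (R : realFieldType) (I : Type) (s : seq I) (P : pred I) (x : I -> R) :
  (forall i, P i -> 0 <= x i <= 1) ->
  1 - \sum_(i <- s | P i) x i <= \prod_(i <- s | P i) (1 - x i).
Proof.
move=> x01; elim: s => [|i s IH]; first by rewrite !big_nil subr0.
rewrite !big_cons; case: ifP => // Pi; have /andP[x0 x1] := x01 i Pi.
have S0 : 0 <= \sum_(j <- s | P j) x j by apply: sumr_ge0 => j /x01 /andP[].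
have : (1 - x i) * (1 - \sum_(j <- s | P j) x j) <= (1 - x i) * \prod_(j <- s | P j) (1 - x j).
  by rewrite ler_wpM2l // subr_ge0.
by apply: le_trans; nra.
Qed.

(** The primes of [n] dividing [M] contribute at least the full product over [s]; the others at
    least [1 - inv_sum], by the union-bound inequality for products. *)
Lemma totient_ge (R : realFieldType) (M : nat) (s : seq nat) (n : nat) :
  (0 < n)%N -> uniq s -> all prime s ->
  {in primes n, forall q, ~~ coprime M q -> q \in s} -> inv_sum R M n <= 1 ->
  n%:R * (\prod_(q <- s) (1 - q%:R^-1) * (1 - inv_sum R M n)) <= (totient n)%:R.
Proof.
move=> n0 us ps sM T1; rewrite totient_prodE // ler_wpM2l // [leRHS](bigID (coprime M)) /= [leRHS]mulrC.
have pn q : q \in primes n -> prime q by rewrite mem_primes => /andP[].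
apply: ler_pM.
- by rewrite big_seq; apply: prodr_ge0 => q /(allP ps) /(@euler_factor_bounds R) /andP[].
- by rewrite subr_ge0.
- rewrite -[leRHS]big_filter; apply: le_euler_prod; rewrite ?filter_uniq ?primes_uniq //.
  by move=> q; rewrite mem_filter => /andP[qM qn]; exact: sM.
rewrite /inv_sum big_seq_cond [leRHS]big_seq_cond.
apply: prod_onem_ge => q /andP[/pn /(@euler_factor_bounds R) /andP[h1 h2] _].
by apply/andP; split; lra.
Qed.

(** The gap [k - a] absorbs the error of [asym_le]. The limit inferior is over real [x], but the
    counts depend on the integer part alone, so a half-line starting at an integer serves as
    neighbourhood of infinity. *)
Lemma lower_density_ge (R : realType) (a k : R) (Q : pred nat) : Bateman_Horn R -> a < k ->
  asym_le (fun X => k * (twin_class xpredT X)%:R) (fun X => (twin_class Q X)%:R) ->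
  (a%:E <= twin_prime_lower_density R Q)%E.
Proof.
move=> BH ak H.
have ev : (\forall X \near \oo, a <= (twin_class Q X)%:R / (twin_class xpredT X)%:R)%classic.
  near=> X.
  have T1 : 1 <= (twin_class xpredT X)%:R :> R by near: X; exact: twins_unbounded.
  have : k * (twin_class xpredT X)%:R
      <= (twin_class Q X)%:R + (k - a) * (twin_class xpredT X)%:R.
    by near: X; apply: H; rewrite subr_gt0.
  by rewrite ler_pdivlMr; lra.
have [N _ HN] := ev.
rewrite /twin_prime_lower_density limf_einfE.
apply: le_trans (ereal_sup_ubound _); last first.
  exists [set x : R | N%:R <= x]%classic; last reflexivity.
  by exists N%:R; split; [exact: num_real|move=> x /ltW].
apply/ereal_infP => _ [x /= Nx <-]; rewrite lee_fin.
have NX : (N <= Num.truncn x)%N by rewrite truncn_ge_nat ?(le_trans _ Nx) ?ler0n.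
have := HN _ NX; rewrite /count_upto.
have -> // : twin_class xpredT (Num.truncn x) = count twin_prime (iota 1 (Num.truncn x)).
by apply: eq_count => p; rewrite /= andbT.
Unshelve. all: by end_near.
Qed.

(** The form in which Markov's inequality is applied: [d] is the density of [C], [t] the room left
    by the small primes, and the finitely many [p <= P0] are negligible. *)
Lemma twin_class_good (R : realType) (M z P0 : nat) (C G : pred nat)
    (b sh : nat -> nat) (d e t : R) :
  Bateman_Horn R -> residue_class M C -> (4 < z)%N ->
  (forall q, prime q -> coprime M q -> [/\ (z <= q)%N, twin_residue q (b q)
     & forall p, prime p -> (q %| sh p)%N = (p %% q == b q)%N]) ->
  (forall p, prime p -> (0 < sh p <= p.+1)%N) ->
  (forall N, \sum_(z <= q < N | prime q) (q%:R * (q%:R - 2))^-1 <= e) ->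
  0 < t -> e <= t ->
  asym_le (fun X => d * (twin_class xpredT X)%:R) (fun X => (twin_class C X)%:R) ->
  (forall p, (P0 < p)%N -> twin_prime p -> C p -> inv_sum R M (sh p) < t -> G p) ->
  asym_le (fun X => (1 - e / t) * d * (twin_class xpredT X)%:R)
    (fun X => (twin_class (fun p => C p && G p) X)%:R).
Proof.
move=> BH CM z4 hq hsh he t0 et dens good.
have c0 : 0 <= 1 - e / t by rewrite subr_ge0 ler_pdivrMr // mul1r.
apply: (@asym_le_trans _ (fun X => (1 - e / t) * (twin_class C X)%:R)).
  apply: asym_le_trans (asym_leZ c0 dens).
  by apply: asym_le_leq => X; rewrite mulrA.
apply: asym_le_trans (twin_class_inv_sum_lt BH CM z4 hq hsh he t0) _.
apply: (@asym_le_trans _ (fun X => (twin_class (fun p => C p && G p) X)%:R + P0%:R)).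
  apply: asym_le_leq => X; rewrite -natrD ler_nat.
  apply: (@leq_trans (twin_class (fun p => C p && G p) X
      + count (fun p => (p <= P0)%N) (iota 1 X))).
    rewrite /twin_class -count_predUI; apply: leq_trans (leq_addr _ _).
    apply: sub_count => p /= /andP[tp /andP[Cp lt]]; rewrite tp Cp /=.
    by case: (leqP p P0); rewrite ?orbT // orbF => P0p; exact: good.
  rewrite leq_add2l -[leqRHS](size_iota 1) -size_filter; apply: uniq_leq_size.
    by rewrite filter_uniq ?iota_uniq.
  by move=> p; rewrite mem_filter !mem_iota !add1n !ltnS => /andP[-> /andP[-> _]].
apply: (@asym_le_trans _ (fun X => (twin_class (fun p => C p && G p) X)%:R + 0)).
  by apply: asym_leD; [exact: asym_le_leq|exact: asym_le_cst].
by apply: asym_le_leq => X; rewrite addr0.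
Qed.

(** Start of the induction on moduli, with density 1, as only [p = 3] is lost; each further prime
    [q] divides the density by [q - 2]. *)
Lemma twins_mod6 (R : realType) : Bateman_Horn R ->
  residue_class (2 * 3) (fun p => p %% 6 == 5)%N /\
  asym_le (fun X => 1 * (twin_class xpredT X)%:R : R)
    (fun X => (twin_class (fun p => p %% 6 == 5)%N X)%:R).
Proof.
move=> BH; split; first by exists 5%N.
apply: (@asym_le_trans _ (fun X => (twin_class (fun p => p %% 6 == 5)%N X)%:R + 1)).
  apply: asym_le_leq => X; rewrite mul1r natr1 ler_nat -addn1.
  have fib := sum_twin_class_fibers xpredT (fun p => p %% 6)%N X (isT : uniq [:: 5%N]).
  rewrite -fib big_seq1 leq_add //.
  apply: leq_trans (_ : size [:: 3%N] <= _)%N => //.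
  rewrite /twin_class -size_filter; apply: uniq_leq_size; first by rewrite filter_uniq ?iota_uniq.
  move=> p; rewrite mem_filter /= !inE => /andP[/andP[/andP[p1 p2] p5] _].
  have d2 : (2 %| p)%N -> p = 2%N by rewrite dvdn_prime2 // => /eqP.
  have d3 : (3 %| p)%N -> p = 3%N by rewrite dvdn_prime2 // => /eqP.
  have d3' : (3 %| p + 2)%N -> (p + 2 = 3)%N by rewrite dvdn_prime2 // => /eqP.
  case: (eqVneq p 2%N) => [e|n2]; first by move: p2; rewrite e.
  case: (eqVneq p 3%N) => [//|n3].
  case: (eqVneq p 1%N) => [e|n1]; first by move: p1; rewrite e.
  by move: d2 d3 d3' n1 n2 n3 p5; clear; lia.
apply: (@asym_le_trans _ (fun X => (twin_class (fun p => p %% 6 == 5)%N X)%:R + 0)).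
  by apply: asym_leD; [exact: asym_le_leq|exact: asym_le_cst].
by apply: asym_le_leq => X; rewrite addr0.
Qed.

Lemma class_density_step (R : realType) (M q b : nat) (C : pred nat) (d : R) :
  Bateman_Horn R -> prime q -> (2 < q)%N -> coprime M q -> twin_residue q b ->
  residue_class M C /\
    asym_le (fun X => d * (twin_class xpredT X)%:R) (fun X => (twin_class C X)%:R) ->
  let C' := fun p => C p && (p %% q == b)%N in
  residue_class (M * q) C' /\
    asym_le (fun X => d / (q%:R - 2) * (twin_class xpredT X)%:R)
      (fun X => (twin_class C' X)%:R).
Proof.
move=> BH pq q2 cMq rb [CM dens] C'; split; first exact: residue_class_step.
have q0 : 0 < q%:R - 2 :> R by rewrite subr_gt0 ltr_nat.
have i0 : 0 <= (q%:R - 2)^-1 :> R by rewrite invr_ge0 ltW.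
have [_ H] := residue_class_density BH CM pq q2 cMq rb.
apply: (@asym_le_trans _ (fun X => (q%:R - 2)^-1 * (d * (twin_class xpredT X)%:R))).
  by apply: asym_le_leq => X; rewrite mulrA [_ / _]mulrC.
apply: asym_le_trans (asym_leZ i0 (asym_le_trans dens H)) _.
by apply: asym_le_leq => X; rewrite mulKf // gt_eqF.
Qed.

(** * The explicit residue classes and the two densities *)

Lemma dvdn_pred_mod (q p : nat) : (1 < q)%N -> (0 < p)%N ->
  (q %| p - 1)%N = (p %% q == 1)%N.
Proof. by move=> q1 p0; rewrite -eqn_mod_dvd // [X in (_ == X)%N]modn_small. Qed.

Lemma dvdn_succ_mod (q p : nat) : (1 < q)%N -> (q %| p + 1)%N = (p %% q == q.-1)%N.
Proof.
move=> q1; have q0 : (0 < q)%N by exact: ltnW.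
rewrite /dvdn -modnDml addn1; have := ltn_pmod p q0.
rewrite leq_eqVlt => /orP[/eqP e|lt].
  by rewrite e modnn eqxx; apply/esym/eqP; rewrite -[in RHS]e.
by rewrite modn_small //=; apply/esym/negbTE; move: lt; clear; lia.
Qed.

(** [1 / 35] is the term of 7 and [1 / 18] bounds the tail from 11. Telescoping from 7 would count 9
    and give [1 / 10], for which the density obtained below would be only about 0.59. *)
Lemma sum_inv_prime_pairs_7 (R : realFieldType) (N : nat) :
  \sum_(7 <= q < N | prime q) (q%:R * (q%:R - 2))^-1 <= 35^-1 + 18^-1 :> R.
Proof.
apply: le_trans (_ : \sum_(7 <= q < 11 + N | prime q) (q%:R * (q%:R - 2))^-1 <= _).
  have [N7|N7] := leqP N 7.
    rewrite big_geq // big_seq_cond; apply: sumr_ge0 => q /andP[].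
    rewrite mem_index_iota => /andP[q7 _] _.
    have qR : 7 <= q%:R :> R by rewrite (ler_nat _ 7).
    by rewrite invr_ge0 mulr_ge0 //; lra.
  rewrite [leRHS](big_cat_nat (n := N)) ?leq_addl ?(ltnW N7) //= lerDl.
  rewrite big_seq_cond; apply: sumr_ge0 => q /andP[].
  rewrite mem_index_iota => /andP[Nq _] _.
  have qR : 7 <= q%:R :> R by rewrite (ler_nat _ 7) (leq_trans (ltnW N7)).
  by rewrite invr_ge0 mulr_ge0 //; lra.
rewrite (big_cat_nat (n := 11%N)) ?leq_addr //=; apply: lerD.
  do 4!rewrite big_ltn_cond //=; rewrite big_geq // addr0.
  by rewrite le_eqVlt; apply/orP; left; apply/eqP; field.
have := @sum_inv_prime_pairs_le R 11 (11 + N) isT isT.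
by rewrite (_ : 2 * (11%:R - 2) = 18 :> R) //; ring.
Qed.

Lemma coprime_primes (M q : nat) (s : seq nat) : prime q -> all prime s ->
  M = (\prod_(l <- s) l)%N -> coprime M q = (q \notin s).
Proof.
move=> pq ps ->; rewrite coprime_sym; elim: s ps => [|l s IH] /=.
  by rewrite big_nil coprimen1.
move=> /andP[pl ps]; rewrite big_cons coprimeMr IH // inE negb_or.
by rewrite prime_coprime // dvdn_prime2.
Qed.

Lemma totient_succ_le (R : realFieldType) (p : nat) : (p %% 6 = 5)%N ->
  (totient (p + 1))%:R <= (p%:R + 1) / 3 :> R.
Proof.
move=> p6; apply: le_trans (@totient_le R [:: 2%N; 3%N] (p + 1) _ isT _) _.
- by rewrite addn1.
- by move: p6; clear => /= p6; rewrite !andbT; apply/andP; split; lia.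
by rewrite !big_cons big_nil natrD le_eqVlt; apply/orP; left; apply/eqP; field.
Qed.

Lemma prime_pred_prime_factors (q : nat) : prime q -> coprime (2 * 3 * 5) q ->
  [/\ (7 <= q)%N, twin_residue q 1
    & forall p, prime p -> (q %| p - 1)%N = (p %% q == 1)%N].
Proof.
move=> pq; rewrite (@coprime_primes _ _ [:: 2; 3; 5]%N) ?big_cons ?big_nil // => q235.
have q7 : (7 <= q)%N by move: pq q235; do 7![case: q => [|q] //].
split=> //; first by rewrite /twin_residue; move: q7; clear; lia.
by move=> p /prime_gt0 p0; rewrite dvdn_pred_mod // (leq_trans _ q7).
Qed.

Lemma prime_succ_prime_factors (q : nat) : prime q -> coprime (2 * 3 * 5 * 7 * 11 * 13) q ->
  [/\ (17 <= q)%N, twin_residue q q.-1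
    & forall p, prime p -> (q %| p + 1)%N = (p %% q == q.-1)%N].
Proof.
move=> pq; rewrite (@coprime_primes _ _ [:: 2; 3; 5; 7; 11; 13]%N) ?big_cons ?big_nil // => qs.
have q17 : (17 <= q)%N by move: pq qs; do 17![case: q => [|q] //].
split=> //; first by rewrite /twin_residue; move: q17; clear; lia.
by move=> p _; rewrite dvdn_succ_mod // (leq_trans _ q17).
Qed.

Lemma density_totient_ge (R : realType) : Bateman_Horn R ->
  (((6513 / 10000 : R)%:E <= twin_prime_lower_density R
     (fun p => (totient (p - 1) >= totient (p + 1))%N))%E).
Proof.
move=> BH; pose G (p : nat) := (totient (p - 1) >= totient (p + 1))%N.
pose e : R := 35^-1 + 18^-1.
(* [t c] must keep [c' (1 - t c)] slightly above [1 / 3], where [c'] bounds the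
   contribution of the prime factors 2 and 5 of [p - 1]. *)
pose t (c : nat) : R := if c == 1%N then 13 / 80 else 13 / 40.
(* All residues modulo 5 except 0 and -2, so only Markov's inequality loses density. *)
pose B := [:: 1; 2; 4]%N.
pose cl (c p : nat) := ((p %% 6 == 5) && (p %% 5 == c))%N.
have good c : c \in B -> asym_le
    (fun X => (1 - e / t c) * (1 / (5 - 2)) * (twin_class xpredT X)%:R)
    (fun X => (twin_class (fun p => cl c p && G p) X)%:R).
  move=> cB.
  have rc : twin_residue 5 c by move: cB; rewrite !inE => /or3P[] /eqP ->.
  have [CM dens] := @class_density_step R (2 * 3) 5 c _ 1 BH isT isT isT rc (twins_mod6 BH).
  have t0 : 0 < t c by rewrite /t; case: ifP => _; lra.
  have et : e <= t c by rewrite /t /e; case: ifP => _; lra.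
  apply: (@twin_class_good R (2 * 3 * 5) 7 500 _ G (fun=> 1%N) (fun p => p - 1)%N
    _ e (t c) BH CM isT prime_pred_prime_factors _ (@sum_inv_prime_pairs_7 R) t0 et dens).
    by move=> p pp; rewrite subn_gt0 prime_gt1 //= leqW // leq_subr.
  move=> p p500 /andP[pp _] /andP[/eqP p6 /eqP p5] lt.
  have p1 : (0 < p - 1)%N by rewrite subn_gt0 prime_gt1.
  pose s := if c == 1%N then [:: 2; 5]%N else [:: 2]%N.
  have ge := @totient_ge R (2 * 3 * 5) s (p - 1) p1.
  have : (p - 1)%:R * (\prod_(q <- s) (1 - q%:R^-1) * (1 - inv_sum R (2 * 3 * 5) (p - 1)))
      <= (totient (p - 1))%:R.
    apply: ge; rewrite /s; [by case: ifP|by case: ifP| |].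
      move=> q; rewrite mem_primes => /and3P[pq _ qd].
      rewrite (@coprime_primes _ _ [:: 2; 3; 5]%N) ?big_cons ?big_nil // negbK.
      move: qd; rewrite dvdn_pred_mod ?prime_gt1 ?prime_gt0 //.
      rewrite !inE => + /or3P[] /eqP qE; rewrite qE => /eqP pq1.
      - by case: ifP.
      - by move: p6 pq1; clear; lia.
      - by rewrite p5 in pq1; rewrite pq1.
    by apply: ltW; apply: lt_le_trans lt _; rewrite /t; case: ifP => _; lra.
  move=> h; rewrite /G -(ler_nat R); apply: le_trans h.
  apply: le_trans (totient_succ_le R p6) _.
  have pR : 501 <= p%:R :> R by rewrite (ler_nat _ 501).
  rewrite natrB ?prime_gt0 //.
  (* [67 / 200 = (2 / 5) * (1 - 13 / 80)], which is below [27 / 80 = (1 / 2) * (1 - 13 / 40)]. The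
     inequality with [(p + 1) / 3] holds from [p = 401] on, whence the cutoff 500. *)
  apply: le_trans (_ : (p%:R - 1) * (67 / 200) <= _); first by lra.
  rewrite ler_wpM2l //; first by lra.
  move: lt; rewrite /s /t; case: ifP => _ lt; rewrite !big_cons big_nil.
    have -> : (1 - 2%:R^-1) * ((1 - 5%:R^-1) * 1) = 2 / 5 :> R by field.
    by lra.
  have -> : (1 - 2%:R^-1) * 1 = 2^-1 :> R by field.
  by lra.
(* The sum is [(395 + 2 * 607) / (3 * 819)], about 0.6549. *)
apply: (@lower_density_ge R _ (\sum_(c <- B) (1 - e / t c) * (1 / (5 - 2)))) => //.
  rewrite /B !big_cons big_nil /t /e /=.
  have -> : 1 - (35^-1 + 18^-1) / (13 / 80) = 395 / 819 :> R by field.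
  have -> : 1 - (35^-1 + 18^-1) / (13 / 40) = 607 / 819 :> R by field.
  have -> : 1 / (5 - 2) = 3^-1 :> R by field.
  lra.
apply: (@asym_le_trans _ (fun X => \sum_(c <- B | c \in B) (twin_class (fun p => cl c p && G p) X)%:R)).
  apply: asym_le_trans (_ : asym_le (fun X => \sum_(c <- B | c \in B)
    (1 - e / t c) * (1 / (5 - 2)) * (twin_class xpredT X)%:R) _).
    by apply: asym_le_leq => X; rewrite -big_seq mulr_suml.
  exact: asym_le_sum.
apply: asym_le_leq => X; rewrite -natr_sum ler_nat -big_seq.
rewrite -[leqRHS](sum_twin_class_fibers G (fun p => p %% 5)%N X (isT : uniq B)).
apply: leq_trans (leq_addr _ _); apply: leq_sum => c _; apply: leq_twin_class => p.
by move=> /andP[/andP[_ pc] Gp]; rewrite Gp pc.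
Qed.

(** The ratio [phi(p - 1) / (p - 1)] must fall below [1 / 3]. Divisibility of [p - 1] by 2, 5 and 7
    only gives [12 / 35], still too large; one more factor 11 or 13 brings it to [24 / 77] or
    [144 / 455]. *)
Lemma density_totient_lt (R : realType) : Bateman_Horn R ->
  (((47 / 10000 : R)%:E <= twin_prime_lower_density R
     (fun p => (totient (p - 1) < totient (p + 1))%N))%E).
Proof.
move=> BH; pose G (p : nat) := (totient (p - 1) < totient (p + 1))%N.
pose e : R := (2 * (17%:R - 2))^-1.
pose M := (2 * 3 * 5 * 7 * 11 * 13)%N.
(* The residues of [p] modulo [(11, 13)], for [p] congruent to 1 modulo 35: either 11 or 13
   divides [p - 1], and neither divides [p + 1]. *)
pose B := [seq (1, v) | v <- iota 1 10] ++ [seq (u, 1) | u <- iota 2 7] : seq (nat * nat).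
(* The exact solutions of [(1 - t) / 3 = 24 / 77] and [(1 - t) / 3 = 144 / 455]. No margin is
   required, since [p - 1 < p + 1] already gives strictness, for every [p]. *)
pose t (uv : nat * nat) : R := if uv.1 == 1%N then 5 / 77 else 23 / 455.
pose cl (uv : nat * nat) (p : nat) := [&& p %% 6 == 5, p %% 5 == 1, p %% 7 == 1,
  p %% 11 == uv.1 & p %% 13 == uv.2]%N.
pose d : R := 1 / (5 - 2) / (7 - 2) / (11 - 2) / (13 - 2).
have inB uv : uv \in B -> [/\ twin_residue 11 uv.1, twin_residue 13 uv.2, uv.1 != 10%N,
    uv.2 != 12%N & (uv.1 == 1%N) || (uv.2 == 1%N)].
  move=> uvB; apply/and5P; move: uv uvB.
  by apply/(@allP _ (fun uv => [&& twin_residue 11 uv.1, twin_residue 13 uv.2, uv.1 != 10%N,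
    uv.2 != 12%N & (uv.1 == 1%N) || (uv.2 == 1%N)])).
have good uv : uv \in B -> asym_le
    (fun X => (1 - e / t uv) * d * (twin_class xpredT X)%:R)
    (fun X => (twin_class (fun p => cl uv p && G p) X)%:R).
  case/inB => r11 r13 n10 n12 one.
  have H5 := @class_density_step R (2 * 3) 5 1 _ _ BH isT isT isT isT (twins_mod6 BH).
  have H7 := @class_density_step R (2 * 3 * 5) 7 1 _ _ BH isT isT isT isT H5.
  have H11 := @class_density_step R (2 * 3 * 5 * 7) 11 uv.1 _ _ BH isT isT isT r11 H7.
  have [CM dens] := @class_density_step R (2 * 3 * 5 * 7 * 11) 13 uv.2 _ _ BH isT isT isT r13 H11.
  have t0 : 0 < t uv by rewrite /t; case: ifP => _; lra.
  have et : e <= t uv.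
    by rewrite /e (_ : 2 * (17%:R - 2) = 30); [rewrite /t; case: ifP => _; lra|ring].
  have he N := @sum_inv_prime_pairs_le R 17 N isT isT.
  apply: asym_le_trans (@twin_class_good R M 17 0 _ G (fun q => q.-1) (fun p => p + 1)%N
    _ e (t uv) BH CM isT prime_succ_prime_factors _ he t0 et dens _) _.
  - by move=> p _; rewrite addn1 leqnn.
  - move=> p _ /andP[pp _] /andP[/andP[/andP[/andP[/eqP p6 /eqP p5] /eqP p7] /eqP p11] /eqP p13] lt.
    have p1 : (0 < p - 1)%N by rewrite subn_gt0 prime_gt1.
    have pR : 2 <= p%:R :> R by rewrite (ler_nat _ 2) prime_gt1.
    have p3 : (0 < p + 1)%N by rewrite addn1.
    have le1 : (p + 1)%:R * (\prod_(q <- [:: 2; 3]%N) (1 - q%:R^-1) * (1 - inv_sum R M (p + 1)))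
        <= (totient (p + 1))%:R.
      apply: totient_ge => //.
        move=> q; rewrite mem_primes => /and3P[pq _].
        rewrite dvdn_succ_mod ?prime_gt1 // => /eqP pq1.
        rewrite (@coprime_primes _ _ [:: 2; 3; 5; 7; 11; 13]%N) ?big_cons ?big_nil // negbK.
        rewrite !inE => /orP[->//|/orP[->|]]; first by rewrite orbT.
        case/or4P => /eqP qE; move: pq1; rewrite qE => pq1; exfalso.
        + by rewrite p5 in pq1.
        + by rewrite p7 in pq1.
        + by move: n10; rewrite -p11 pq1.
        + by move: n12; rewrite -p13 pq1.
      by apply: ltW; apply: lt_le_trans lt _; rewrite /t; case: ifP => _; lra.
    pose s := if uv.1 == 1%N then [:: 2; 5; 7; 11]%N else [:: 2; 5; 7; 13]%N.
    have le2 : (totient (p - 1))%:R <= (p - 1)%:R * \prod_(q <- s) (1 - q%:R^-1) :> R.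
      have p0 := prime_gt0 pp.
      have p2 : (p %% 2 = 1)%N by move: p6; clear; lia.
      apply: totient_le => //; rewrite /s; case: ifP => // u1 /=.
        by rewrite !dvdn_pred_mod // p2 p5 p7 p11 (eqP u1).
      by rewrite u1 /= in one; rewrite !dvdn_pred_mod // p2 p5 p7 p13 (eqP one).
    rewrite /G -(ltr_nat R); apply: le_lt_trans le2 (lt_le_trans _ le1).
    rewrite natrB ?prime_gt0 // natrD !big_cons big_nil.
    have -> : (1 - 2%:R^-1) * ((1 - 3%:R^-1) * 1) = 3^-1 :> R by field.
    move: lt; rewrite /s /t; case: ifP => _ lt; rewrite !big_cons big_nil.
      have -> : (1 - 2%:R^-1) * ((1 - 5%:R^-1) * ((1 - 7%:R^-1) * ((1 - 11%:R^-1) * 1)))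
        = 24 / 77 :> R by field.
      apply: (@lt_le_trans _ _ ((p%:R + 1) * (24 / 77))); first by lra.
      by rewrite ler_wpM2l //; lra.
    have -> : (1 - 2%:R^-1) * ((1 - 5%:R^-1) * ((1 - 7%:R^-1) * ((1 - 13%:R^-1) * 1)))
      = 144 / 455 :> R by field.
    apply: (@lt_le_trans _ _ ((p%:R + 1) * (144 / 455))); first by lra.
    by rewrite ler_wpM2l //; lra.
  apply: asym_le_leq => X; rewrite ler_nat leq_twin_class // => p.
  by rewrite /cl -!andbA.
(* The sum is [(10 * 73 / 150 + 7 * 47 / 138) / 1485], about 0.00488. *)
apply: (@lower_density_ge R _ (\sum_(uv <- B) (1 - e / t uv) * d)) => //.
  have dE : d = 1485^-1 by rewrite /d; field.
  have eE : e = 30^-1 by rewrite /e; congr (_^-1); ring.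
  rewrite /B big_cat !big_map /= !big_cons !big_nil /t /= dE eE.
  have -> : 1 - 30^-1 / (5 / 77) = 73 / 150 :> R by field.
  have -> : 1 - 30^-1 / (23 / 455) = 47 / 138 :> R by field.
  lra.
apply: (@asym_le_trans _ (fun X => \sum_(uv <- B | uv \in B)
    (twin_class (fun p => cl uv p && G p) X)%:R)).
  apply: asym_le_trans (_ : asym_le (fun X => \sum_(uv <- B | uv \in B)
    (1 - e / t uv) * d * (twin_class xpredT X)%:R) _).
    by apply: asym_le_leq => X; rewrite -big_seq mulr_suml.
  exact: asym_le_sum.
apply: asym_le_leq => X; rewrite -natr_sum ler_nat -big_seq.
rewrite -[leqRHS](sum_twin_class_fibers G (fun p => (p %% 11, p %% 13))%N X (isT : uniq B)).
apply: leq_trans (leq_addr _ _); apply: leq_sum => -[u v] _; apply: leq_twin_class => p.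
by move=> /andP[/and5P[_ _ _ pu pv] Gp]; rewrite Gp xpair_eqE pu pv.
Qed.

Unset Implicit Arguments.
Set Strict Implicit.

Theorem theorem1 (R : realType) (BH : Bateman_Horn R) :
  ((47 / 10000 : R)%:E <=
     twin_prime_lower_density R
       (fun p => (totient (p - 1) < totient (p + 1))%N))%E
  /\
  ((6513 / 10000 : R)%:E <=
     twin_prime_lower_density R
       (fun p => (totient (p - 1) >= totient (p + 1))%N))%E.
Proof. by split; [exact: density_totient_lt|exact: density_totient_ge]. Qed.
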